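(* Let $0<r\leq 1$ and, for each $n\ge 1$, let $X_n\subseteq S^1$ be a set of $n$ points chosen independently and uniformly at random from $S^1$. Let $\mathrm{per}(X_n,r)$ be the number of periodic points of $f_r\colon X_n\to X_n$. Then \[ \lim_{n\to\infty}\frac{\mathbf{E}[\mathrm{per}(X_n,r)]}{n}=\begin{cases} 0 & \text{if } r\notin\mathbb{Q},\\ \frac{1}{q} & \text{if } r=\frac{p}{q} \text{ with } p,q \text{ coprime positive integers.}\end{cases}\]
   Context: $S^1=\mathbb{R}/\mathbb{Z}$ is the circle of unit circumference with the arc-length metric. For $x,y\in S^1$, $\vec{d}(x,y)$ denotes the clockwise distance from $x$ to $y$, and $[x,y)_{S^1}$ etc. denote clockwise arcs from $x$ to $y$. For a finite $X\subseteq S^1$ and $0<r\le 1$, the map $f_r\colon X\to X$ sends $x$ to the element of $X\cap[x,x+r)_{S^1}$ that is clockwise furthest from $x$. A point $x\in X$ is periodic if $f_r^i(x)=x$ for some $i\ge 1$. *)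

(* Defs.v *)
From HB Require Import structures.
From mathcomp Require Import all_boot all_order all_algebra generic_quotient.
From mathcomp Require Import finmap.
From mathcomp Require Import all_classical all_reals all_analysis.

Set Implicit Arguments.
Unset Strict Implicit.
Unset Printing Implicit Defensive.

Import Order.TTheory GRing.Theory Num.Theory.
Import numFieldNormedType.Exports.

Local Open Scope classical_set_scope.
Local Open Scope ring_scope.
Local Open Scope quotient_scope.

Section circle_type.
Variable R : realType.

Definition eqmod1 (x y : R) : bool := x - y \is a Num.int.

Fact eqmod1_refl : reflexive eqmod1.
Proof. by move=> x; rewrite /eqmod1 subrr rpred0. Qed.

Fact eqmod1_sym : symmetric eqmod1.
Proof. by move=> x y; rewrite /eqmod1 -opprB rpredN. Qed.

Fact eqmod1_trans : transitive eqmod1.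
Proof.
by move=> y x z xy yz; rewrite /eqmod1 -(subrK y x) -addrA; exact: rpredD.
Qed.

Canonical eqmod1_equiv :=
  EquivRel eqmod1 eqmod1_refl eqmod1_sym eqmod1_trans.

Definition circle : Type := {eq_quot eqmod1}.

HB.instance Definition _ := Choice.on circle.
HB.instance Definition _ := Quotient.on circle.
HB.instance Definition _ := EqQuotient.on circle.
HB.instance Definition _ := isPointed.Build circle (\pi_circle (0 : R)).

Definition to_circle (x : R) : circle := \pi_circle x.

End circle_type.

Fact circle_display : measure_display. Proof. exact: default_measure_display. Qed.

(* The quotient sigma-algebra: A is measurable iff its preimage in R is Borel.
   This is the Borel sigma-algebra of the arc-length metric, since [0, 1[ -> R/Z
   is a continuous bijection with Borel inverse. *)
Section circle_measurable.
Variable R : realType.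

Definition circle_measurable : set (set (circle R)) :=
  [set A | measurable (@to_circle R @^-1` A)].

Fact circle_measurable0 : circle_measurable set0.
Proof. by rewrite /circle_measurable /= preimage_set0. Qed.

Fact circle_measurableC (A : set (circle R)) :
  circle_measurable A -> circle_measurable (~` A).
Proof. by rewrite /circle_measurable /= preimage_setC; exact: measurableC. Qed.

Fact circle_measurable_bigcup (F : (set (circle R))^nat) :
  (forall i, circle_measurable (F i)) -> circle_measurable (\bigcup_i F i).
Proof.
by move=> mF; rewrite /circle_measurable /= preimage_bigcup; exact: bigcupT_measurable.
Qed.

HB.instance Definition _ := isMeasurable.Build circle_display (circle R)
  circle_measurable0 circle_measurableC circle_measurable_bigcup.

End circle_measurable.

Definition circle_uniform (R : realType) : set (circle R) -> \bar R :=
  pushforward (uniform_prob (@ltr01 R)) (@to_circle R).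

(* Clockwise is the direction of increasing real representatives; the
   clockwise distance from x to y is the unique t in [0, 1[ with y = x + t. *)
Definition cdist (R : realType) (x y : circle R) : R :=
  let t := repr y - repr x : R in t - (Num.floor t)%:~R.

Lemma cdistE (R : realType) (a b : R) :
  cdist (to_circle a) (to_circle b) = (b - a) - (Num.floor (b - a))%:~R.
Proof.
have reprE (c : R) : exists k : int, repr (to_circle c) = c + k%:~R.
  have /eqmodP : repr (to_circle c) = c %[mod circle R] by rewrite reprK.
  by move=> /intrP[k hk]; exists k; rewrite -hk addrC subrK.
rewrite /cdist; have [k ->] := reprE a; have [l ->] := reprE b.
have -> : b + l%:~R - (a + k%:~R) = (b - a) + (l - k)%:~R :> R.
  by rewrite opprD addrACA intrB.
rewrite real_floorDrz ?num_real ?intr_int// intrKfloor [in X in _ - X]intrD.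
by rewrite opprD addrACA subrr addr0.
Qed.

(* The arc [x, x + r[ (the whole circle when r = 1). *)
Definition clockwise_arc (R : realType) (x : circle R) (r : R) : pred (circle R) :=
  fun y => cdist x y < r.

(* For r > 0 the point x lies in its own arc, and the maximiser is unique as
   cdist x is injective. *)
Definition cyclic_map (R : realType) (X : {fset circle R}) (r : R) (x : X) : X :=
  [arg max_(y > x | clockwise_arc (val x) r (val y)) cdist (val x) (val y)]%O.

Definition periodic_point (T : Type) (f : T -> T) (x : T) : Prop :=
  exists2 i : nat, (1 <= i)%N & iter i f x = x.

Definition per (R : realType) (X : {fset circle R}) (r : R) : nat :=
  #|[pred x : X | `[< periodic_point (@cyclic_map R X r) x >]]|.

Definition mutually_independent (R : realType) (d d' : measure_display)
    (T : measurableType d) (S : measurableType d') (P : probability T R)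
    (I : finType) (X : I -> {RV P >-> S}) : Prop :=
  forall (J : {set I}) (A : I -> set S), (forall i, measurable (A i)) ->
    P (\bigcap_(i in [set` J]) X i @^-1` A i) =
      (\prod_(i in J) P (X i @^-1` A i))%E.

Definition uniform_on_circle (R : realType) (d : measure_display)
    (T : measurableType d) (P : probability T R)
    (X : {RV P >-> circle R}) : Prop :=
  forall A : set (circle R), measurable A ->
    distribution P X A = circle_uniform A.

Definition point_set (R : realType) (T : Type) (n : nat)
    (X : 'I_n -> T -> circle R) (w : T) : {fset circle R} :=
  [fset X i w | i in 'I_n]%fset.

(* Main.v *)
(* Write [rho] for the rotation by [r].  Cut out arcs of length [1/D], one at
   each of [Q] consecutive images of a base arc under [rho]; a point in the
   [j]th arc has colour [j], and its offset inside the arc is its position.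
   Since [f_r] moves a point to the last point before its image under [rho], it
   raises the colour by one and slightly lowers the position.  Reading the
   points by decreasing position, [f_r] is thus simulated by tokens: a token of
   colour [j - 1] waits for the next point of colour [j] and then takes its
   colour, merging with a token already there.  Periodic points are always hit
   by a token.  Given the positions, the colours are independent and uniform, so
   the gaps between tokens perform unbiased random walks absorbed at [0]; a
   quadratic potential in the gaps shows that few tokens survive.
   If [r = p/q], take [Q = D = q]: the arcs tile the circle, the colours form a
   cycle, and in the long run one token is left, which hits a fraction [1/q] of
   the points.  For the matching lower bound, the first periodic point read
   starts a greedy walk all of whose points are periodic.
   If [r] is irrational, new tokens enter at colour [0], but with [Q] large their
   density is still arbitrarily small.
   Positions are discretised into cells, so that everything depends on a finite
   random label per point; two points share a cell with negligible probability. *)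
Require Import Defs.
From mathcomp Require Import all_boot all_order all_algebra.
From mathcomp Require Import generic_quotient finmap ring lra zify.
From mathcomp Require Import all_classical all_reals all_analysis.
From mathcomp Require Import measurable_realfun.

Set Implicit Arguments.
Unset Strict Implicit.
Unset Printing Implicit Defensive.

Import Order.TTheory GRing.Theory Num.Theory.
Import numFieldNormedType.Exports.

Local Open Scope classical_set_scope.
Local Open Scope ring_scope.

(** * Averaging over colours; tokens *)

Section averaging.
Variables (R : realFieldType) (Q n : nat).
Local Notation colour := 'I_Q.+1.

(** Translating the colour at [i] by a fixed [k] permutes the colourings and leaves [g j] unchanged.
    Averaging over [k] makes the colour at [i] an independent uniform [j]. *)
Lemma sum_resample (i : 'I_n) (g : colour -> {ffun 'I_n -> colour} -> R) :
  (forall j (c c' : {ffun 'I_n -> colour}), (forall k, k != i -> c k = c' k) -> g j c = g j c') ->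
  Q.+1%:R * (\sum_(c : {ffun 'I_n -> colour}) g (c i) c) = \sum_j \sum_c g j c.
Proof.
move=> gE; pose upd k (c : {ffun 'I_n -> colour}) : {ffun 'I_n -> colour} :=
  [ffun l => if l == i then c l + k else c l].
have updK k : cancel (upd k) (upd (- k)).
  by move=> c; apply/ffunP => l; rewrite !ffunE; case: eqP => // _; rewrite addrK.
transitivity (\sum_(k : colour) \sum_(c : {ffun 'I_n -> colour}) g (c i) c).
  by rewrite sumr_const card_ord mulr_natl.
transitivity (\sum_(k : colour) \sum_(c : {ffun 'I_n -> colour}) g (c i + k) c).
  apply: eq_bigr => k _; rewrite (reindex_inj (can_inj (updK k))) /=.
  apply: eq_bigr => c _; rewrite ffunE eqxx; apply: gE => l lNi.
  by rewrite ffunE (negPf lNi).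
rewrite exchange_big [RHS]exchange_big /=; apply: eq_bigr => c _.
by rewrite [RHS](reindex_inj (addrI (c i))).
Qed.

(** A drift bound: if one uniformly coloured step raises [Psi] by at most [b] on average, then
    [size sigma] steps raise it by at most [b] each. Since [sigma] has no repetition, the colour of
    its head is independent of the later ones and can be resampled. *)
Lemma sum_foldl_le (S : Type) (step : S -> colour -> S) (Psi : S -> R) (b : R) :
  (forall s, \sum_j Psi (step s j) <= Q.+1%:R * (Psi s + b)) ->
  forall (sigma : seq 'I_n) s, uniq sigma ->
  \sum_(c : {ffun 'I_n -> colour}) Psi (foldl step s (map c sigma)) <=
    (Q.+1 ^ n)%:R * (Psi s + b * (size sigma)%:R).
Proof.
move=> PsiS; elim=> [|i sigma IH] s /=.
  by rewrite mulr0 addr0 sumr_const card_ffun !card_ord mulr_natl.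
move=> /andP[iNs us].
have Q0 : 0 < Q.+1%:R :> R by rewrite ltr0n.
rewrite -(ler_pM2l Q0).
rewrite (sum_resample (g := fun j c => Psi (foldl step (step s j) (map c sigma)))).
  apply: le_trans (_ : \sum_j (Q.+1 ^ n)%:R * (Psi (step s j) + b * (size sigma)%:R) <= _).
    by apply: ler_sum => j _; exact: IH.
  rewrite -mulr_sumr mulrCA ler_wpM2l ?ler0n// big_split /= sumr_const card_ord.
  rewrite -[_ *+ Q.+1]mulr_natl -(natr1 (size sigma)).
  rewrite (_ : _ * (Psi s + _) = Q.+1%:R * (Psi s + b) +
    Q.+1%:R * (b * (size sigma)%:R)); last by ring.
  by rewrite lerD2r; exact: PsiS.
move=> j c c' cE; congr (Psi (foldl _ _ _)).
by apply/eq_in_map => k ks; apply: cE; apply: contraNneq iNs => <-.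
Qed.

End averaging.

Section tokens.
Variables (R : realFieldType) (Q : nat) (src : bool).
Local Notation colour := 'I_Q.+1.
Implicit Types (eta : colour -> bool) (a c e : colour).

Definition next_colour : colour := inZp 1.

(* [eta e] says that a token of colour [e] is alive; if [src] holds, tokens are
   also created at every point of colour [0]. *)
Definition hit eta c := eta (c - next_colour) || (src && (c == 0)).

(** The order of the tests matters when [Q = 0]: there [c - next_colour = c], and the first branch
    keeps the only token alive. *)
Definition advance eta c : colour -> bool := fun e =>
  if e == c then eta c || hit eta c
  else if e == c - next_colour then false else eta e.

Definition read (s : (colour -> bool) * nat) c : (colour -> bool) * nat :=
  (advance s.1 c, (s.2 + hit s.1 c)%N).

Definition occupied eta a l := has (fun k => eta (a + next_colour *+ k)) (iota 0 l).

(** This encodes the gaps between tokens: a window of [l] consecutive colours is not counted exactly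
    when it lies inside a gap. *)
Definition occupancy eta l : R := \sum_a (occupied eta a l)%:R.

Lemma next_mulrn k : next_colour *+ k = inZp k.
Proof. by rewrite Zp_mulrn; apply: val_inj; rewrite /= modnMml mul1n. Qed.

Lemma addr_next_inj a k l : (k < l)%N -> (l <= Q)%N ->
  (a + next_colour *+ k == a + next_colour *+ l) = false.
Proof.
move=> kl lQ; apply/negP => /eqP /addrI; rewrite !next_mulrn => /(congr1 val) /=.
by rewrite !modn_small; lia.
Qed.

Lemma occupiedP eta a l :
  reflect (exists2 k, (k < l)%N & eta (a + next_colour *+ k)) (occupied eta a l).
Proof.
apply: (iffP hasP) => -[k]; first by rewrite mem_iota => kl ?; exists k.
by move=> kl ?; exists k => //; rewrite mem_iota.
Qed.

(** Apart from creation at colour 0, a move affects a window only across its ends. Reading [c = a]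
    lets a token enter from [a - 1], so the window extended to the left was occupied. Reading
    [c = a + l] lets the token on the last colour leave, so the window without that colour was
    occupied. Any other move stays inside or outside. *)
Lemma occupied_advance eta c a l : (0 < l <= Q)%N ->
  occupied (advance eta c) a l ->
  [|| if c == a then occupied eta (a - next_colour) l.+1
      else if c == a + next_colour *+ l then occupied eta a l.-1 else occupied eta a l
    | src && (c == 0) && occupied (pred1 0) a l].
Proof.
move=> /andP[l0 lQ] /occupiedP[k kl]; rewrite {1}/advance.
have inE' : eta (a + next_colour *+ k) -> occupied eta (a - next_colour) l.+1.
  by move=> h; apply/occupiedP; exists k.+1; rewrite // mulrS addrA subrK.
case: eqP => [kc|kc].
  rewrite /hit; case/or3P => [h|h|/andP[-> c0]].
  - apply/orP; left; case: eqP => [_|_]; first by apply: inE'; rewrite kc.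
    rewrite -kc addr_next_inj//.
    by apply/occupiedP; exists k => //; rewrite kc.
  - apply/orP; left; case: eqP => [ca|ca].
      by apply/occupiedP; exists 0; rewrite ?addr0 -?ca.
    rewrite -kc addr_next_inj//; apply/occupiedP.
    case: k kl {inE'} kc => [|k] kl kc; first by rewrite addr0 in kc; rewrite kc in ca.
    exists k; first lia.
    by move: h; rewrite -kc mulrS addrCA addrC addrK.
  - apply/orP; right; rewrite c0 /=; apply/occupiedP; exists k => //=.
    by rewrite kc.
case: eqP => // kc1 h; apply/orP; left; case: eqP => [_|_]; first exact: inE'.
case: eqP => [cl|_]; last by apply/occupiedP; exists k.
apply/occupiedP; exists k => //.
suff : k != l.-1 by lia.
apply/eqP => kE; apply: kc1; rewrite cl kE -{2}(prednK l0) mulrS addrCA.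
by rewrite addrC addrK.
Qed.

Lemma sum_occupied_pred1 a0 l : \sum_a (occupied (pred1 a0) a l)%:R <= l%:R :> R.
Proof.
apply: le_trans (_ : \sum_a \sum_(k < l) (a == a0 - next_colour *+ k)%:R <= _).
  apply: ler_sum => a _; case: occupiedP => [[k kl /eqP <-]|_]; last first.
    by apply: sumr_ge0 => i _; rewrite ler0n.
  rewrite (bigD1 (Ordinal kl)) //= addrK eqxx lerDl.
  by apply: sumr_ge0 => i _; rewrite ler0n.
rewrite exchange_big /= (eq_bigr (fun=> 1)) ?sumr_const ?card_ord// => k _.
rewrite (bigD1 (a0 - next_colour *+ k)) //= eqxx big1 ?addr0// => i /negPf ->.
by [].
Qed.

(** For each window just two of the [Q.+1] colours matter, [a] and [a + l], distinct because
    [l <= Q]. Summed over [a], they contribute the second difference in [l]; the source can only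
    fill the [l] windows through colour 0. *)
Lemma sum_occupancy_advance eta l : (0 < l <= Q)%N ->
  \sum_c occupancy (advance eta c) l <=
  Q.+1%:R * occupancy eta l + (occupancy eta l.+1 - 2 * occupancy eta l +
    occupancy eta l.-1) + src%:R * l%:R.
Proof.
move=> lQ; rewrite exchange_big /=.
apply: le_trans (_ : \sum_a (Q.+1%:R * (occupied eta a l)%:R +
   ((occupied eta (a - next_colour) l.+1)%:R - 2 * (occupied eta a l)%:R +
    (occupied eta a l.-1)%:R) + src%:R * (occupied (pred1 0) a l)%:R) <= _).
  apply: ler_sum => a _.
  have alN : (a + next_colour *+ l == a) = false.
    by rewrite eq_sym -{1}(addr0 a) -(mulr0n next_colour) addr_next_inj; lia.
  apply: le_trans (_ : \sum_c ((occupied eta a l)%:R +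
     (c == a)%:R * ((occupied eta (a - next_colour) l.+1)%:R - (occupied eta a l)%:R) +
     (c == a + next_colour *+ l)%:R * ((occupied eta a l.-1)%:R - (occupied eta a l)%:R)
     + (c == 0)%:R * (src%:R * (occupied (pred1 0) a l)%:R)) <= _).
    apply: ler_sum => c _; have := @occupied_advance eta c a l lQ.
    set A := occupied (advance _ _) _ _; set B := (if _ then _ else _).
    set w := occupied (pred1 0) a l => AB.
    rewrite [X in _ <= X + _](_ : _ = B%:R); last first.
      rewrite /B; case: eqP => [->|_]; first by rewrite [a == _]eq_sym alN /=; ring.
      by case: eqP => _ /=; ring.
    move: AB; case: A; last by rewrite addr_ge0// ?mulr_ge0// ler0n.
    move=> /(_ isT) /orP[->|/andP[/andP[-> ->] ->]].
      by rewrite lerDl ?mulr_ge0// ler0n.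
    by rewrite !mul1r lerDr ler0n.
  have delta (x : R) c0 : \sum_c (c == c0)%:R * x = x.
    rewrite (bigD1 c0) //= eqxx mul1r big1 ?addr0// => c /negPf ->.
    by rewrite mul0r.
  by rewrite !big_split /= !delta sumr_const card_ord -mulr_natl; lra.
rewrite !big_split /= -!mulr_sumr sumrN -mulr_sumr.
have -> : \sum_a (occupied eta (a - next_colour) l.+1)%:R = occupancy eta l.+1.
  rewrite (reindex_inj (addIr next_colour)) /=.
  by apply: eq_bigr => a _; rewrite addrK.
have := sum_occupied_pred1 0 l; rewrite /occupancy.
by case: src => /=; lra.
Qed.

Lemma occupancy_ge0 eta l : 0 <= occupancy eta l.
Proof. by apply: sumr_ge0 => a _; rewrite ler0n. Qed.

Lemma occupancy_le eta l : occupancy eta l <= Q.+1%:R.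
Proof.
apply: le_trans (_ : \sum_(a : colour) 1 <= _); last by rewrite sumr_const card_ord.
by apply: ler_sum => a _; case: occupied.
Qed.

Lemma occupancy0 eta : occupancy eta 0 = 0.
Proof. by rewrite /occupancy big1. Qed.

(** Summation by parts: the weights are linear in [l], so only boundary terms remain. Raising [G] by
    one adds one to every weight, that is, one telescoping sum of second differences. *)
Lemma sum_second_difference (f : nat -> R) G :
  \sum_(1 <= l < G.+1) (G.+1%:R - l%:R) * (f l.+1 - 2 * f l + f l.-1) =
  f G.+1 - G.+1%:R * f 1%N + G%:R * f 0%N.
Proof.
have tele k : \sum_(1 <= l < k.+1) (f l.+1 - 2 * f l + f l.-1) =
    f k.+1 - f k - f 1%N + f 0%N.
  elim: k => [|k IH]; first by rewrite big_geq//; ring.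
  by rewrite big_nat_recr//= IH; ring.
elim: G => [|G IH]; first by rewrite big_geq//; ring.
transitivity (\sum_(1 <= l < G.+1) (G.+1%:R - l%:R) * (f l.+1 - 2 * f l + f l.-1)
   + \sum_(1 <= l < G.+2) (f l.+1 - 2 * f l + f l.-1)); last first.
  by rewrite IH tele -!natr1; ring.
rewrite !(big_nat_recr G.+1)//= addrA -big_split /=; congr (_ + _); last by rewrite -!natr1; ring.
by apply: eq_bigr => l _; rewrite -!natr1; ring.
Qed.

(* On average, [occupancy] obeys the discrete heat equation in [l]; summation by
   parts turns the weights [G - l] into [occupancy G - G * occupancy 1], and
   [occupancy 1] is the number of tokens. *)
Definition potential G eta : R := \sum_(1 <= l < G) (G%:R - l%:R) * occupancy eta l.

Lemma potential_ge0 G eta : 0 <= potential G eta.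
Proof.
rewrite /potential big_nat; apply: sumr_ge0 => l /andP[_ lG].
by rewrite mulr_ge0 ?occupancy_ge0// subr_ge0 ler_nat ltnW.
Qed.

Lemma potential_le G eta : potential G eta <= G%:R * G%:R * Q.+1%:R.
Proof.
apply: le_trans (_ : \sum_(1 <= l < G) G%:R * Q.+1%:R <= _).
  rewrite /potential !big_nat; apply: ler_sum => l /andP[_ lG].
  by rewrite ler_pM ?occupancy_ge0 ?occupancy_le ?subr_ge0 ?ler_nat ?(ltnW lG)//
       gerBl ler0n.
rewrite sumr_const_nat -[leLHS]mulr_natl mulrA.
by rewrite !ler_wpM2r ?ler0n// ler_nat leq_subr.
Qed.

(** The source costs at most [G ^ 2] for each of at most [G] window lengths, hence the cubic
    term. *)
Lemma sum_potential_advance G eta : (0 < G <= Q.+1)%N ->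
  \sum_c potential G (advance eta c) <=
  Q.+1%:R * potential G eta + (occupancy eta G - G%:R * occupancy eta 1) +
    src%:R * G%:R ^+ 3.
Proof.
case: G => // G /= GQ; rewrite /potential exchange_big /=.
apply: le_trans (_ : \sum_(1 <= l < G.+1) (Q.+1%:R * ((G.+1%:R - l%:R) *
  occupancy eta l) + (G.+1%:R - l%:R) * (occupancy eta l.+1 - 2 * occupancy eta l
   + occupancy eta l.-1) + src%:R * G.+1%:R ^+ 2) <= _).
  rewrite !big_nat; apply: ler_sum => l /andP[l0 lG].
  rewrite -mulr_sumr.
  have d0 : 0 <= G.+1%:R - l%:R :> R by rewrite subr_ge0 ler_nat ltnW.
  have lQ : (0 < l <= Q)%N by lia.
  have := ler_wpM2l d0 (sum_occupancy_advance eta lQ).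
  have : (G.+1%:R - l%:R) * l%:R <= G.+1%:R ^+ 2 :> R.
    by rewrite expr2 ler_pM ?ler0n// ?ler_nat ?(ltnW lG)// gerBl ler0n.
  by case: src => /=; rewrite ?mul1r ?mul0r !mulrDr; lra.
rewrite !big_split /= sum_second_difference -mulr_sumr occupancy0 mulr0 addr0 lerD2l.
rewrite sumr_const_nat -[leLHS]mulr_natr subn1 /= -mulrA ler_wpM2l ?ler0n//.
by rewrite [leRHS]exprS mulrC ler_wpM2r ?ler_nat ?exprn_ge0 ?ler0n.
Qed.

Lemma sum_hit_le eta : \sum_c (hit eta c)%:R <= occupancy eta 1 + src%:R :> R.
Proof.
apply: le_trans (_ : \sum_c ((eta (c - next_colour))%:R + (c == 0)%:R * src%:R) <= _).
  apply: ler_sum => c _; rewrite /hit; case: (eta _); case: (c == 0); case: src => /=; lra.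
rewrite big_split /=; apply: lerD.
  rewrite (reindex_inj (addIr next_colour)) /= /occupancy; apply: ler_sum => a _.
  by rewrite addrK /occupied /= addr0 orbF.
rewrite (bigD1 0)//= mul1r big1 ?addr0// => c /negPf ->.
by rewrite mul0r.
Qed.

(** The bound obtained for the probability that a reading step is a hit. Without a source,
    [G = Q.+1] gives [1 / Q.+1]; with a source, [G] is fixed first and then [Q] is taken large. *)
Definition hit_rate G : R := G%:R^-1 + src%:R * (1 + G%:R ^+ 2) / Q.+1%:R.

Lemma sum_hits_le n G eta (sigma : seq 'I_n) : (0 < G <= Q.+1)%N -> uniq sigma ->
  \sum_(c : {ffun 'I_n -> colour}) (foldl read (eta, 0%N) (map c sigma)).2%:R <=
  (Q.+1 ^ n)%:R * (hit_rate G * (size sigma)%:R + G%:R * Q.+1%:R).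
Proof.
(* The expected number of new hits is about [occupancy 1 / Q.+1]. The potential divided by [G] loses
   that amount on average, up to the terms collected in [hit_rate], so the sum grows at most at that
   rate. *)
move=> GQ us; pose Psi (s : (colour -> bool) * nat) : R := s.2%:R + potential G s.1 / G%:R.
have G0 : 0 < G%:R :> R by rewrite ltr0n; lia.
have Q0 : 0 < Q.+1%:R :> R by rewrite ltr0n.
have drift s : \sum_j Psi (read s j) <= Q.+1%:R * (Psi s + hit_rate G).
  rewrite /Psi /= big_split /=.
  under eq_bigr do rewrite natrD.
  rewrite big_split /= sumr_const card_ord -mulr_natl -mulr_suml.
  have h1 := sum_hit_le s.1.
  have h2 := sum_potential_advance s.1 GQ.
  have h3 := occupancy_le s.1 G.
  have h4 : (\sum_c potential G (advance s.1 c)) / G%:R <=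
     Q.+1%:R * (potential G s.1 / G%:R) + (Q.+1%:R / G%:R - occupancy s.1 1) + src%:R * G%:R ^+ 2.
    rewrite ler_pdivrMr//.
    rewrite (_ : _ * G%:R = Q.+1%:R * potential G s.1 + (Q.+1%:R - G%:R * occupancy s.1 1)
      + src%:R * G%:R ^+ 3); last by field; rewrite lt0r_neq0.
    lra.
  rewrite (_ : Q.+1%:R * _ = Q.+1%:R * s.2%:R + Q.+1%:R * (potential G s.1 / G%:R) + Q.+1%:R / G%:R +
     src%:R + src%:R * G%:R ^+ 2); last first.
    by rewrite /hit_rate; field; rewrite nat1r !lt0r_neq0.
  by lra.
apply: le_trans (_ : \sum_(c : {ffun 'I_n -> colour})
   Psi (foldl read (eta, 0%N) (map c sigma)) <= _).
  apply: ler_sum => c _; rewrite /Psi lerDl.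
  by rewrite divr_ge0 ?potential_ge0// ltW.
apply: le_trans (sum_foldl_le drift _ us) _.
rewrite ler_wpM2l ?ler0n// addrC lerD2l /Psi /= add0r ler_pdivrMr//.
by rewrite (le_trans (potential_le _ _))// mulrAC.
Qed.

End tokens.

(** * Deterministic comparison of marked points with tokens and with a greedy walk *)

Section reading.
Variables (Q : nat) (src : bool) (I : eqType).
Local Notation colour := 'I_Q.+1.
Local Notation next_colour := (next_colour Q).
Variables (col : I -> colour) (cell : I -> nat) (B : pred I) (sigma : seq I).
Hypothesis sorted_sigma : pairwise (fun i k => cell k < cell i)%N sigma.

Lemma pairwise_split rho i tau : sigma = rho ++ i :: tau ->
  (forall k, k \in rho -> cell i < cell k)%N /\
  (forall k, k \in tau -> cell k < cell i)%N.
Proof.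
move=> E; move: sorted_sigma; rewrite E pairwise_cat pairwise_cons.
case/and3P => /allrelP h1 _ /andP[/allP h2 _]; split => k kr; last exact: h2.
by apply: h1; rewrite ?mem_head.
Qed.

(** In the third case no point of the colour of [i] is read between [m] and [i], so a token placed
    at [m] is still waiting when [i] is read. In the second case the token present initially is
    still waiting; in the first the source provides one. *)
Lemma count_le_hits :
  (forall i, i \in sigma -> B i ->
    [\/ src && (col i == 0),
        forall k, k \in sigma -> (cell i < cell k)%N -> col k != col i |
        exists m, [/\ m \in sigma, B m, col m = col i - next_colour, (cell i < cell m)%N &
          forall k, k \in sigma -> col k = col i -> (cell i < cell k)%N ->
            (cell m <= cell k)%N]]) ->
  (count B sigma <= (foldl (read src) (fun=> true, 0%N) (map col sigma)).2)%N.
Proof.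
move=> hB.
(* [rho] is the part already read. A colour has a token as long as its successor has not been read,
   and a point of [B] leaves a token that stays until a point of the next colour is read. *)
suff gen tau : forall rho (eta : colour -> bool) cnt, sigma = rho ++ tau ->
    (forall e, (forall k, k \in rho -> col k != e + next_colour) -> eta e) ->
    (forall m, m \in rho -> B m ->
      (forall k, k \in rho -> col k = col m + next_colour -> (cell m <= cell k)%N) ->
      eta (col m)) ->
    (cnt + count B tau <= (foldl (read src) (eta, cnt) (map col tau)).2)%N.
  by rewrite -[leqLHS]add0n; apply: (gen sigma [::]).
elim: tau => [|i tau IH] rho eta cnt E inv1 inv2 /=; first by rewrite addn0.
have [rhoi itau] := pairwise_split E.
have isg : i \in sigma by rewrite E mem_cat mem_head orbT.
have rs k : k \in rho -> k \in sigma by rewrite E mem_cat => ->.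
have Bhit : B i -> hit src eta (col i).
  move=> Bi; rewrite /hit; case: (hB i isg Bi) => [->|h|[m [ms Bm cm im mk]]].
  - by rewrite orbT.
  - by rewrite inv1// => k kr; rewrite subrK; apply: h => //; [exact: rs|exact: rhoi].
  - rewrite -cm inv2//.
      move: ms; rewrite E mem_cat inE => /or3P[//|/eqP mi|/itau]; last by lia.
      by move: im; rewrite mi ltnn.
    move=> k kr; rewrite cm subrK => ki; apply: mk => //; [exact: rs|exact: rhoi].
rewrite {2}/read /=.
apply: leq_trans (IH (rcons rho i) _ _ _ _ _).
- by rewrite addnA leq_add2r leq_add2l; case: (B i) Bhit => // ->.
- by rewrite cat_rcons.
- move=> e he; rewrite /advance; have := he i; rewrite mem_rcons mem_head => /(_ isT) ie.
  have ee : eta e by apply: inv1 => k kr; apply: he; rewrite mem_rcons inE kr orbT.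
  case: eqP => [<-|_]; first by rewrite ee.
  by case: eqP => // eE; move: ie; rewrite eE subrK eqxx.
- move=> m; rewrite mem_rcons inE => /orP[/eqP -> Bi _|mr Bm hm].
    by rewrite /advance eqxx Bhit ?orbT.
  have em : eta (col m).
    by apply: inv2 => // k kr; apply: hm; rewrite mem_rcons inE kr orbT.
  rewrite /advance; case: eqP => [<-|_]; first by rewrite em.
  case: eqP => // mE; have := hm i; rewrite mem_rcons mem_head mE subrK.
  by move=> /(_ isT erefl); have := rhoi m mr; lia.
Qed.

(* The colour of the walker is [x] modulo [Q.+1]; counting without the modulus
   makes the walk monotone in its starting point. *)
Definition walk (x : nat) (c : colour) : nat := if c == inZp x.+1 then x.+1 else x.

(** A step gains at most one, so the lower walk can catch up but not overtake, and walks that meet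
    coincide from then on. *)
Lemma foldl_walk_le x y (l : seq colour) : (x <= y)%N ->
  (foldl walk x l <= foldl walk y l)%N.
Proof.
elim: l x y => //= c l IH x y xy; apply: IH; rewrite /walk.
have [->|xNy] := eqVneq x y; first by [].
by do 2 case: ifP => _; lia.
Qed.

Lemma inZpS x : inZp x.+1 = inZp x + next_colour :> colour.
Proof. by rewrite -!next_mulrn -mulrSr. Qed.

Lemma foldl_walk_le_count z : z \in sigma -> B z ->
  (forall k, k \in sigma -> (cell z < cell k)%N -> col k != col z) ->
  (forall i k, i \in sigma -> B i -> k \in sigma -> (cell k < cell i)%N ->
    col k = col i + next_colour ->
    (forall l, l \in sigma -> col l = col k -> (cell l < cell i)%N ->
      (cell l <= cell k)%N) -> B k) ->
  (foldl walk 0 (map col sigma) <= Q + count B sigma)%N.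
Proof.
move=> zs Bz z1 Bstep; pose s : nat := nat_of_ord (col z - next_colour)%R.
apply: leq_trans (foldl_walk_le (map col sigma) (leq0n s)) _.
apply: leq_trans (_ : s + count B sigma <= _)%N; last first.
  by rewrite leq_add2r -ltnS ltn_ord.
(* Either the walker still waits for [z], or its last jump was at some [i] of [B] and no point of
   the next colour has been read since. *)
suff gen tau : forall rho x, sigma = rho ++ tau ->
    (inZp x.+1 = col z /\ forall k, k \in rho -> col k != col z) \/
    (exists i, [/\ i \in rho, B i, inZp x = col i & forall k, k \in rho ->
       (cell k < cell i)%N -> col k != col i + next_colour]) ->
    (foldl walk x (map col tau) <= x + count B tau)%N.
  apply: (gen sigma [::]) => //; left; split => //.
  by rewrite inZpS -[X in _ = X](subrK next_colour) valZpK.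
elim: tau => [|i tau IH] rho x E J /=; first by rewrite addn0.
have [rhoi itau] := pairwise_split E.
have isg : i \in sigma by rewrite E mem_cat mem_head orbT.
have rs k : k \in rho -> k \in sigma by rewrite E mem_cat => ->.
rewrite {2}/walk; case: eqP => [ci|ci]; last first.
  apply: leq_trans (IH (rcons rho i) x _ _) _; first by rewrite cat_rcons.
  - case: J => [[xz rz]|[k [kr Bk xk hk]]].
      left; split => // k; rewrite mem_rcons inE => /orP[/eqP ->|/rz //].
      by rewrite -xz; apply/eqP.
    right; exists k; split => //; first by rewrite mem_rcons inE kr orbT.
    move=> l; rewrite mem_rcons inE => /orP[/eqP -> _|/hk //].
    by rewrite -xk -inZpS; apply/eqP.
  - by rewrite leq_add2l leq_addl.
have Bi : B i.
  case: J => [[xz rz]|[k [kr Bk xk hk]]].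
    move: zs; rewrite E mem_cat inE => /or3P[/rz|/eqP <- //|/itau zi].
      by rewrite eqxx.
    by have := z1 i isg zi; rewrite ci xz eqxx.
  apply: (Bstep k i) => //; [exact: rs|exact: rhoi|by rewrite ci inZpS xk|].
  move=> l; rewrite {1}E mem_cat inE => /or3P[lr|/eqP -> //|/itau /ltnW //].
  by move=> li lk; have := hk l lr lk; rewrite li ci inZpS xk eqxx.
apply: leq_trans (IH (rcons rho i) x.+1 _ _) _; first by rewrite cat_rcons.
- right; exists i; split=> //; first by rewrite mem_rcons mem_head.
  move=> k; rewrite mem_rcons inE => /orP[/eqP ->|/rhoi]; first by rewrite ltnn.
  by lia.
- by rewrite Bi; lia.
Qed.

End reading.

Lemma sum_walk_ge (R : realFieldType) (Q n : nat) (sigma : seq 'I_n) : uniq sigma ->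
  (Q.+1 ^ n)%:R * ((size sigma)%:R / Q.+1%:R) <=
  \sum_(c : {ffun 'I_n -> 'I_Q.+1}) (foldl (@walk Q) 0%N (map c sigma))%:R :> R.
Proof.
move=> us; have Q0 : Q.+1%:R != 0 :> R by rewrite pnatr_eq0.
(* The walk advances for one colour out of [Q.+1]. The drift lemma bounds from above, so it is
   applied to the negated position. *)
have drift x : \sum_j - (walk x (j : 'I_Q.+1))%:R <= Q.+1%:R * (- x%:R - Q.+1%:R^-1) :> R.
  rewrite mulrDr !mulrN divff// (eq_bigr (fun j => - x%:R - (j == inZp x.+1)%:R)).
    rewrite big_split /= !sumrN sumr_const card_ord (bigD1 (inZp x.+1))//= eqxx big1.
      by rewrite addr0 mulr_natl.
    by move=> j /negPf ->.
  by move=> j _; rewrite /walk; case: eqP => _ /=; rewrite -?natr1; lra.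
rewrite -lerN2 -sumrN; apply: le_trans (sum_foldl_le drift 0%N us) _.
by rewrite oppr0 add0r mulNr mulrN [_^-1 * _]mulrC.
Qed.

(** * Means under a product law *)

Section product_mean.
Variables (R : realFieldType) (Z : finType) (mu : Z -> R) (n : nat).
Implicit Types f g : {ffun 'I_n -> Z} -> R.

Definition pmean f : R := \sum_(y : {ffun 'I_n -> Z}) (\prod_i mu (y i)) * f y.

Hypothesis mu_ge0 : forall z, 0 <= mu z.
Hypothesis mu_sum : \sum_z mu z = 1.

Lemma pmean_le f g : (forall y, f y <= g y) -> pmean f <= pmean g.
Proof.
by move=> fg; apply: ler_sum => y _; rewrite ler_wpM2l// prodr_ge0.
Qed.

Lemma pmeanD f g : pmean (fun y => f y + g y) = pmean f + pmean g.
Proof. by rewrite -big_split /=; apply: eq_bigr => y _; rewrite mulrDr. Qed.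

Lemma pmeanZ a f : pmean (fun y => a * f y) = a * pmean f.
Proof. by rewrite mulr_sumr; apply: eq_bigr => y _; rewrite mulrCA. Qed.

Lemma pmean_sum (I : finType) (f : I -> {ffun 'I_n -> Z} -> R) :
  pmean (fun y => \sum_i f i y) = \sum_i pmean (f i).
Proof. by rewrite exchange_big /=; apply: eq_bigr => y _; rewrite mulr_sumr. Qed.

Lemma pmean_prod (F : 'I_n -> Z -> R) :
  pmean (fun y => \prod_i F i (y i)) = \prod_i \sum_z mu z * F i z.
Proof. by rewrite bigA_distr_bigA /=; apply: eq_bigr => y _; rewrite -big_split. Qed.

Lemma pmean_cst a : pmean (fun=> a) = a.
Proof.
rewrite -[RHS]mulr1 -[X in pmean X](_ : (fun y => a * (\prod_(i < n) 1)) = _).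
  rewrite pmeanZ (pmean_prod (fun _ _ => 1)); congr (_ * _).
  by apply: big1 => i _; under eq_bigr do rewrite mulr1.
by apply: boolp.funext => y; rewrite big1// mulr1.
Qed.

Lemma pmean_coord i (g : Z -> R) : pmean (fun y => g (y i)) = \sum_z mu z * g z.
Proof.
transitivity (pmean (fun y => \prod_k (if k == i then g (y k) else 1))).
  apply: eq_bigr => y _; congr (_ * _).
  by rewrite (bigD1 i)//= eqxx big1 ?mulr1// => k /negPf ->.
rewrite (pmean_prod (fun k z => if k == i then g z else 1)) (bigD1 i)//= eqxx.
rewrite [X in _ * X]big1 ?mulr1// => k /negPf ->.
by under eq_bigr do rewrite mulr1.
Qed.

Lemma pmean_coord2 i k (g h : Z -> R) : i != k ->
  pmean (fun y => g (y i) * h (y k)) =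
  (\sum_z mu z * g z) * (\sum_z mu z * h z).
Proof.
move=> ik; pose F j z := if j == i then g z else if j == k then h z else 1.
transitivity (pmean (fun y => \prod_j F j (y j))).
  apply: eq_bigr => y _; congr (_ * _).
  rewrite (bigD1 i)//= (bigD1 k) ?(eq_sym k)//= big1 /F ?eqxx.
    by rewrite eq_sym (negPf ik) mulr1.
  by move=> j /andP[/negPf -> /negPf ->].
rewrite pmean_prod (bigD1 i)//= (bigD1 k) ?(eq_sym k)//= [X in _ * (_ * X)]big1.
  rewrite /F !eqxx; by rewrite eq_sym (negPf ik) mulr1.
by rewrite /F => j /andP[/negPf -> /negPf ->]; under eq_bigr do rewrite mulr1.
Qed.

Lemma pmean_map (phi : 'I_n -> Z -> Z) f :
  (forall i, injective (phi i)) -> (forall i z, mu (phi i z) = mu z) ->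
  pmean (fun y : {ffun 'I_n -> Z} => f [ffun i => phi i (y i)]) = pmean f.
Proof.
move=> phiI phimu; rewrite [RHS](reindex_inj (h := fun y : {ffun 'I_n -> Z} => [ffun i => phi i (y i)])) /=.
  apply: eq_bigr => y _; congr (_ * _); apply: eq_bigr => i _.
  by rewrite ffunE phimu.
move=> y y' /ffunP E; apply/ffunP => i; apply: (phiI i).
by have := E i; rewrite !ffunE.
Qed.

End product_mean.

(** * Random labels made of a cell and a colour *)

Section cells.
Variables (R : realFieldType) (M Q n : nat).
Local Notation colour := 'I_Q.+1.
Local Notation label := (option ('I_M.+1 * colour)).
Implicit Types y : {ffun 'I_n -> label}.

(** The values at [None], here and for colours, are defaults that never matter: only labelled
    indices are read or can collide. *)
Definition label_cell (z : label) : nat := if z is Some mc then mc.1 else 0%N.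
Definition label_colour (z : label) : colour := if z is Some mc then mc.2 else 0.

Definition reading_order y : seq 'I_n :=
  sort (fun i k => label_cell (y k) <= label_cell (y i))%N
    [seq i <- enum 'I_n | y i].

Definition collision y := [exists i, exists k,
  [&& i != k, isSome (y i), isSome (y k) & label_cell (y i) == label_cell (y k)]].

Lemma mem_reading_order y i : (i \in reading_order y) = isSome (y i).
Proof. by rewrite mem_sort mem_filter mem_enum andbT. Qed.

Lemma uniq_reading_order y : uniq (reading_order y).
Proof. by rewrite sort_uniq filter_uniq// enum_uniq. Qed.

Lemma size_reading_order y :
  (size (reading_order y))%:R = \sum_i (isSome (y i))%:R :> R.
Proof.
by rewrite size_sort size_filter -sum1_count big_mkcond big_enum /= natr_sum;
  apply: eq_bigr => i _; case: (y i).
Qed.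

Lemma count_reading_order y (B : pred 'I_n) :
  count B (reading_order y) = #|[pred i | isSome (y i) && B i]|.
Proof.
rewrite count_sort count_filter -sum1_count -sum1_card big_enum_cond /=.
by apply: eq_bigl => i; rewrite !inE andbC.
Qed.

Lemma pairwise_reading_order y : ~~ collision y ->
  pairwise (fun i k => label_cell (y k) < label_cell (y i))%N (reading_order y).
Proof.
move=> yN; have /= := uniq_reading_order y; rewrite uniq_pairwise => nd.
have : pairwise (fun i k => label_cell (y k) <= label_cell (y i))%N (reading_order y).
  rewrite -sorted_pairwise; last by move=> i j k /=; lia.
  by apply: sort_sorted => i k; apply: leq_total.
move=> pw; have := conj nd pw => /andP; rewrite -pairwise_relI.
apply: (@sub_in_pairwise _ (mem (reading_order y))); last exact/allP.
have memE j : (j \in mem (reading_order y)) = isSome (y j) by rewrite -mem_reading_order.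
move=> i k; rewrite !memE => yi yk /= /andP[ik].
rewrite leq_eqVlt => /predU1P[E|//]; case/negP: yN.
by apply/existsP; exists i; apply/existsP; exists k; rewrite ik yi yk E eqxx.
Qed.

Variable w : R.
Hypothesis w_ge0 : 0 <= w.
Hypothesis w_le : M.+1%:R * Q.+1%:R * w <= 1.

Definition label_weight (z : label) : R :=
  if z is Some _ then w else 1 - M.+1%:R * Q.+1%:R * w.

Local Notation mean := (pmean label_weight).

Lemma label_weight_ge0 z : 0 <= label_weight z.
Proof. by case: z => //=; rewrite subr_ge0. Qed.

Lemma sum_label_weight (g : label -> R) :
  \sum_z label_weight z * g z =
  label_weight None * g None + w * \sum_m \sum_c g (Some (m, c)).
Proof.
rewrite (bigD1 None)//=; congr (_ + _).
rewrite (reindex_onto Some (odflt (ord0, 0))) /=; last by case.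
rewrite (eq_bigl predT); last by move=> mc; rewrite /= eqxx.
rewrite pair_big /= mulr_sumr; apply: eq_bigr => -[m c] _ //.
Qed.

Lemma label_weight_sum : \sum_z label_weight z = 1.
Proof.
under eq_bigr do rewrite -[label_weight _]mulr1.
rewrite sum_label_weight mulr1 sumr_const sumr_const !card_ord /=.
by rewrite -mulrnA natrM [w * _]mulrC (mulrC Q.+1%:R) subrK.
Qed.

(** Rotating the colour of each label separately preserves the weights, the cells and hence the
    reading order. Averaging over all rotations therefore makes the colours independent and uniform
    given the cells. *)
Lemma mean_recolour (F : seq colour -> R) :
  mean (fun y : {ffun 'I_n -> label} => F [seq label_colour (y i) | i <- reading_order y]) =
  mean (fun y => (Q.+1 ^ n)%:R^-1 *
    \sum_(c : {ffun 'I_n -> colour}) F (map c (reading_order y))).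
Proof.
pose rot (k : colour) (z : label) : label :=
  if z is Some mc then Some (mc.1, mc.2 + k) else None.
pose rots (c : {ffun 'I_n -> colour}) y : {ffun 'I_n -> label} := [ffun i => rot (c i) (y i)].
have rotI k : injective (rot k).
  by apply: (@can_inj _ _ _ (rot (- k))) => -[[m c]|] //=; rewrite addrK.
have rotmu k z : label_weight (rot k z) = label_weight z by case: z.
have N0 : (Q.+1 ^ n)%:R != 0 :> R by rewrite pnatr_eq0 -lt0n expn_gt0.
rewrite pmeanZ pmean_sum; apply: (mulfI N0); rewrite mulVKf//.
transitivity (\sum_(c : {ffun 'I_n -> colour}) mean (fun y =>
   F [seq label_colour (rots c y i) | i <- reading_order (rots c y)])).
  have -> : (Q.+1 ^ n)%:R = #|{: {ffun 'I_n -> colour}}|%:R :> R.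
    by rewrite card_ffun !card_ord.
  rewrite mulr_natl -sumr_const.
  apply: eq_bigr => c _; apply/esym.
  exact: (@pmean_map R label label_weight n (fun i => rot (c i)) (fun y =>
    F [seq label_colour (y i) | i <- reading_order y])).
rewrite -!pmean_sum; apply: eq_bigr => y _; congr (_ * _).
rewrite [RHS](reindex_inj (h := fun c : {ffun 'I_n -> colour} =>
   [ffun i => label_colour (y i) + c i])) /=; last first.
  move=> c c' /ffunP E; apply/ffunP => i; have := E i; rewrite !ffunE.
  exact: addrI.
apply: eq_bigr => c _; congr F.
have cellE i : label_cell (rots c y i) = label_cell (y i) by rewrite ffunE; case: (y i).
have someE i : isSome (rots c y i) = isSome (y i) by rewrite ffunE; case: (y i).
have -> : reading_order (rots c y) = reading_order y.
  rewrite /reading_order; congr sort; last by apply: eq_filter.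
  by apply: boolp.funext => i; apply: boolp.funext => k; rewrite !cellE.
apply/eq_in_map => i; rewrite mem_reading_order !ffunE.
by case: (y i).
Qed.

Lemma mean_size_reading_order :
  mean (fun y : {ffun 'I_n -> label} => (size (reading_order y))%:R) =
  n%:R * (M.+1%:R * Q.+1%:R * w).
Proof.
transitivity (mean (fun y : {ffun 'I_n -> label} => \sum_i (isSome (y i))%:R)).
  by apply: eq_bigr => y _; rewrite size_reading_order.
rewrite pmean_sum (eq_bigr (fun=> M.+1%:R * Q.+1%:R * w)).
  by rewrite sumr_const card_ord -[LHS]mulr_natl.
move=> i _; rewrite (pmean_coord label_weight_sum i (fun z => (isSome z)%:R)).
rewrite sum_label_weight mulr0 add0r /= sumr_const sumr_const !card_ord.
by rewrite -mulrnA natrM [LHS]mulrC (mulrC M.+1%:R).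
Qed.

(** A union bound over ordered pairs and cells: two given points share a given cell with probability
    [(Q.+1 * w) ^ 2], and there are [M.+1] cells. *)
Lemma mean_collision_le : Q.+1%:R * M.+1%:R * w <= 1 ->
  mean (fun y : {ffun 'I_n -> label} => (collision y)%:R) <= n%:R ^+ 2 / M.+1%:R.
Proof.
move=> wQ; pose at_ (m : 'I_M.+1) (z : label) : R :=
  if z is Some mc then (mc.1 == m)%:R else 0.
apply: le_trans (_ : mean (fun y : {ffun 'I_n -> label} =>
   \sum_(ik : 'I_n * 'I_n) (ik.1 != ik.2)%:R * \sum_m at_ m (y ik.1) * at_ m (y ik.2)) <= _).
  apply: pmean_le => [z|y]; first exact: label_weight_ge0.
  have at0 m z : 0 <= at_ m z by case: z => //= mc; rewrite ler0n.
  have s0 i k : 0 <= \sum_m at_ m (y i) * at_ m (y k).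
    by apply: sumr_ge0 => m _; rewrite mulr_ge0.
  have s1 (ik : 'I_n * 'I_n) : 0 <= (ik.1 != ik.2)%:R * \sum_m at_ m (y ik.1) * at_ m (y ik.2).
    by rewrite mulr_ge0 ?ler0n.
  have [/existsP[i /existsP[k /and4P[ik]]]|_] := boolP (collision y); last first.
    by apply: sumr_ge0 => ik _; exact: s1.
  case yi : (y i) => [[m c]|]//; case yk : (y k) => [[m' c']|]// _ _ /= /eqP/val_inj mm.
  rewrite (bigD1 (i, k))//= ik mul1r (bigD1 m)//= yi yk /= mm eqxx mulr1 -addrA lerDl.
  rewrite addr_ge0//; apply: sumr_ge0 => j _; first by rewrite mulr_ge0 ?ler0n.
  exact: s1.
rewrite pmean_sum; apply: le_trans (_ : \sum_(ik : 'I_n * 'I_n) M.+1%:R^-1 <= _); last first.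
  by rewrite sumr_const card_prod !card_ord -[leLHS]mulr_natl natrM expr2.
apply: ler_sum => -[i k] _ /=; rewrite pmeanZ.
have [_|ik] := eqVneq i k; first by rewrite mul0r invr_ge0 ler0n.
rewrite mul1r pmean_sum (eq_bigr (fun=> (Q.+1%:R * w) * (Q.+1%:R * w))).
  have M0 : 0 < M.+1%:R :> R by rewrite ltr0n.
  rewrite sumr_const card_ord -[leLHS]mulr_natl -[leRHS]mul1r ler_pdivlMr//.
  rewrite [leLHS](_ : _ = (Q.+1%:R * M.+1%:R * w) ^+ 2); last by ring.
  by rewrite exprn_ile1// !mulr_ge0 ?ler0n.
move=> m _; rewrite (pmean_coord2 label_weight_sum)//.
have -> : \sum_z label_weight z * at_ m z = Q.+1%:R * w.
  rewrite sum_label_weight mulr0 add0r (bigD1 m)//= [X in _ + X]big1 ?addr0.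
    by rewrite eqxx sumr_const card_ord mulrC.
  by move=> k' /negPf km; rewrite km big1.
by [].
Qed.

Lemma mean_hits_le src G : (0 < G <= Q.+1)%N ->
  mean (fun y : {ffun 'I_n -> label} => (foldl (read src) (fun=> true, 0%N)
    [seq label_colour (y i) | i <- reading_order y]).2%:R) <=
  hit_rate R Q src G * (n%:R * (M.+1%:R * Q.+1%:R * w)) + G%:R * Q.+1%:R.
Proof.
move=> GQ; rewrite (mean_recolour (fun l => (foldl (read src) (fun=> true, 0%N) l).2%:R)).
rewrite -mean_size_reading_order.
rewrite -(pmean_cst n label_weight_sum (G%:R * Q.+1%:R)) -pmeanZ -pmeanD.
apply: pmean_le => [z|y]; first exact: label_weight_ge0.
rewrite mulrC ler_pdivrMr ?ltr0n ?expn_gt0// [leRHS]mulrC.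
exact: sum_hits_le GQ (uniq_reading_order y).
Qed.

Lemma mean_walk_ge :
  n%:R * (M.+1%:R * w) <=
  mean (fun y : {ffun 'I_n -> label} => (foldl (@walk Q) 0%N
    [seq label_colour (y i) | i <- reading_order y])%:R).
Proof.
rewrite (mean_recolour (fun l => (foldl (@walk Q) 0%N l)%:R)).
rewrite (_ : _ * _ = Q.+1%:R^-1 * (n%:R * (M.+1%:R * Q.+1%:R * w))); last first.
  by field; rewrite nat1r pnatr_eq0.
rewrite -mean_size_reading_order -pmeanZ.
apply: pmean_le => [z|y]; first exact: label_weight_ge0.
rewrite [leRHS]mulrC ler_pdivlMr ?ltr0n ?expn_gt0// [leLHS]mulrC [X in _ * X]mulrC.
exact: sum_walk_ge (uniq_reading_order y).
Qed.

End cells.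

(** * Coordinates on the circle *)

Section cdist_theory.
Variable R : realType.
Implicit Types x y z : circle R.

Lemma int_eq0 (u : R) : u \is a Num.int -> `|u| < 1 -> u = 0.
Proof.
move=> /intrP[k ->]; rewrite -intr_norm ltrz1.
by rewrite -[k]/(k) => ?; have -> : k = 0 by lia.
Qed.

Lemma int_sub_eq (u v : R) : 0 <= u < 1 -> 0 <= v < 1 -> u - v \is a Num.int -> u = v.
Proof.
move=> /andP[u0 u1] /andP[v0 v1] uv; apply/eqP; rewrite -subr_eq0; apply/eqP.
by apply: int_eq0; rewrite // ltr_norml; lra.
Qed.

Lemma cdist_itv x y : 0 <= cdist x y < 1.
Proof.
rewrite /cdist; have := floor_itv (repr y - repr x).
by rewrite intrD => /andP[]; lra.
Qed.

Lemma cdist_int x y : cdist x y - (repr y - repr x) \is a Num.int.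
Proof.
by rewrite /cdist addrAC subrr add0r rpredN intr_int.
Qed.

Lemma cdist_uniq x y (u : R) : 0 <= u < 1 ->
  u - (repr y - repr x) \is a Num.int -> cdist x y = u.
Proof.
move=> u01 ui; apply: int_sub_eq => //; first exact: cdist_itv.
rewrite (_ : _ - _ = (cdist x y - (repr y - repr x)) - (u - (repr y - repr x))).
  by rewrite rpredB// cdist_int.
ring.
Qed.

Lemma repr_to_circle (a : R) : repr (to_circle a) - a \is a Num.int.
Proof.
have : repr (to_circle a) = a %[mod circle R]%qT by rewrite reprK.
by move/eqmodP.
Qed.

Lemma cdist_inj x : injective (cdist x).
Proof.
move=> y z E; rewrite -[y]reprK -[z]reprK; apply/eqmodP.
change (repr y - repr z \is a Num.int).
rewrite (_ : _ - _ = (cdist x z - (repr z - repr x)) - (cdist x y - (repr y - repr x))).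
  by rewrite rpredB// cdist_int.
by rewrite E; ring.
Qed.

Lemma cdistxx x : cdist x x = 0.
Proof. by apply: cdist_uniq; rewrite ?lexx ?ltr01// subrr subr0 rpred0. Qed.

End cdist_theory.

(** * Maximality and periodicity for the cyclic map *)

Section cyclic_map_theory.
Variables (R : realType) (X : {fset circle R}) (r : R).
Hypothesis r_gt0 : 0 < r.
Local Notation f := (@cyclic_map R X r).

Lemma cyclic_map_lt (y : X) : cdist (val y) (val (f y)) < r.
Proof.
by rewrite /cyclic_map; case: arg_maxP => //; rewrite /clockwise_arc cdistxx.
Qed.

Lemma cyclic_map_max (y z : X) : cdist (val y) (val z) < r ->
  cdist (val y) (val z) <= cdist (val y) (val (f y)).
Proof.
rewrite /cyclic_map; case: arg_maxP => [|i _ im]; first by rewrite /clockwise_arc cdistxx.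
by move=> /im.
Qed.

Lemma periodic_cyclic_map (y : X) : periodic_point f y -> periodic_point f (f y).
Proof. by move=> [i i1 fi]; exists i => //; rewrite -iterSr iterS fi. Qed.

Lemma periodic_pred (x : X) : periodic_point f x ->
  exists2 y, periodic_point f y & f y = x.
Proof.
move=> [[//|i] _ fi]; exists (iter i f x); last by rewrite -iterS.
by exists i.+1 => //; rewrite iterSr -iterS fi.
Qed.

Lemma periodic_exists (x : X) : exists y, periodic_point f y.
Proof.
have /trajectP[i io E] := looping_order f x.
exists (iter i f x); exists (order f x - i)%N; first by rewrite subn_gt0.
by rewrite -iterD subnK// ltnW.
Qed.

End cyclic_map_theory.

Section coordinates.
Variables (R : realType) (r : R).
Hypotheses (r_gt0 : 0 < r) (r_le1 : r <= 1).
Implicit Types x y z : circle R.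

(* [f_r] turns the value of the [j]th coordinate into a slightly smaller value of
   the [j+1]st one. *)
Definition rcoord (j : nat) x : R := cdist (to_circle (j%:R * r)) x.

Lemma rcoord_itv j x : 0 <= rcoord j x < 1.
Proof. exact: cdist_itv. Qed.

Lemma rcoord_int j x : rcoord j x - (repr x - j%:R * r) \is a Num.int.
Proof.
rewrite (_ : _ - _ = (rcoord j x - (repr x - repr (to_circle (j%:R * r)))) -
  (repr (to_circle (j%:R * r)) - j%:R * r)); last by ring.
by rewrite rpredB ?repr_to_circle// cdist_int.
Qed.

Lemma rcoord_uniq j x (u : R) : 0 <= u < 1 ->
  u - (repr x - j%:R * r) \is a Num.int -> rcoord j x = u.
Proof.
move=> u01 ui; apply: int_sub_eq => //; first exact: rcoord_itv.
rewrite (_ : _ - _ = (rcoord j x - (repr x - j%:R * r)) - (u - (repr x - j%:R * r))).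
  by rewrite rpredB// rcoord_int.
ring.
Qed.

Variables (j k : nat).
Hypothesis jk : j.+1%:R * r - k%:R * r \is a Num.int.

(** Used with [x] the image of [y]. By [jk], the [j]th coordinate of [y] exceeds the [k]th one of
    [x] by [r - cdist y x], which is positive. A point [x'] above [x] by less than this would lie in
    the arc of [y] beyond [x]. *)
Lemma rcoord_pred x x' y : cdist y x < r ->
  (cdist y x' < r -> cdist y x' <= cdist y x) ->
  rcoord k x < rcoord k x' -> rcoord k x < rcoord j y <= rcoord k x'.
Proof.
have r1 := r_le1; move: (cdist_itv y x) (cdist_int y x) (rcoord_itv k x) (rcoord_int k x)
  (rcoord_itv k x') (rcoord_int k x').
move: (cdist y x) (rcoord k x) (rcoord k x') => s u v /andP[s0 s1] si /andP[u0 u1] ui.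
move=> /andP[v0 v1] vi sr yx' uv.
have gap : r - s <= v - u.
  have [//|vus] := lerP (r - s) (v - u).
  have E : cdist y x' = s + (v - u).
    apply: cdist_uniq; first by lra.
    rewrite (_ : _ - _ = (s - (repr x - repr y)) +
      ((v - (repr x' - k%:R * r)) - (u - (repr x - k%:R * r)))); last by ring.
    by apply: rpredD => //; exact: rpredB.
  have : cdist y x' <= s by apply: yx'; rewrite E; lra.
  by rewrite E; lra.
have -> : rcoord j y = u + (r - s).
  apply: rcoord_uniq; first by lra.
  rewrite (_ : _ - _ = (u - (repr x - k%:R * r)) -
    (s - (repr x - repr y)) + (j.+1%:R * r - k%:R * r)); last by rewrite -natr1; ring.
  by apply: rpredD => //; exact: rpredB.
lra.
Qed.

(** Used with [z] the image of [x]. By [jk], [x'] lies at distance [r - (rcoord j x - rcoord k x')]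
    from [x], hence in its arc, and [z] is at least as far. *)
Lemma rcoord_succ x x' z : cdist x z < r ->
  (cdist x x' < r -> cdist x x' <= cdist x z) ->
  rcoord k x' < rcoord j x -> rcoord j x - rcoord k x' < r ->
  rcoord k x' <= rcoord k z < rcoord j x.
Proof.
have [r0 r1] := (r_gt0, r_le1); move: (cdist_itv x z) (cdist_int x z) (rcoord_itv j x) (rcoord_int j x)
  (rcoord_itv k x') (rcoord_int k x').
move: (cdist x z) (rcoord j x) (rcoord k x') => s t t' /andP[s0 s1] si /andP[u0 u1] ti.
move=> /andP[v0 v1] ti' sr xx' tt' tr.
have E : cdist x x' = r - (t - t').
  apply: cdist_uniq; first by lra.
  rewrite (_ : _ - _ = (t' - (repr x' - k%:R * r)) -
    (t - (repr x - j%:R * r)) + (j.+1%:R * r - k%:R * r)); last by rewrite -natr1; ring.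
  by apply: rpredD => //; exact: rpredB.
have {}xx' : r - (t - t') <= s by rewrite -E; apply: xx'; rewrite E; lra.
have -> : rcoord k z = t + s - r.
  apply: rcoord_uniq; first by lra.
  rewrite (_ : _ - _ = (t - (repr x - j%:R * r)) +
    (s - (repr z - repr x)) - (j.+1%:R * r - k%:R * r)); last by rewrite -natr1; ring.
  by apply: rpredB => //; exact: rpredD.
lra.
Qed.

End coordinates.

(** * Arcs, cells and labels on the circle *)

Section labels.
Variables (R : realType) (r : R) (D M Q : nat).
Local Notation colour := 'I_Q.+1.
Local Notation rcoord := (rcoord r).
Implicit Types (x : circle R) (a : nat) (j k : colour).

(* [a < D] selects one of [D] families of [Q.+1] arcs, and [j] is the colour of an
   arc within its family. *)
Definition window a (j : nat) x : bool := a%:R <= D%:R * rcoord j x < a.+1%:R.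

Definition in_cell a (j m : nat) x : bool :=
  (a * M.+1 + m)%:R <= M.+1%:R * D%:R * rcoord j x < (a * M.+1 + m).+1%:R.

(* [None] for points outside the arcs of the [a]th family. *)
Definition label a x : option ('I_M.+1 * colour) :=
  [pick mc : 'I_M.+1 * colour | in_cell a mc.2 mc.1 x].

Lemma in_cell_window a j (m : 'I_M.+1) x : in_cell a j m x -> window a j x.
Proof.
have M0 : 0 < M.+1%:R :> R by rewrite ltr0n.
rewrite /in_cell /window -mulrA => /andP[h1 h2].
rewrite -(ler_pM2l M0) -[X in _ && X](ltr_pM2l M0) -!natrM; apply/andP; split.
  by apply: le_trans h1; rewrite ler_nat; lia.
by apply: lt_le_trans h2 _; rewrite ler_nat; have := ltn_ord m; lia.
Qed.

Lemma window_in_cell a j x : window a j x -> exists m : 'I_M.+1, in_cell a j m x.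
Proof.
have M0 : 0 < M.+1%:R :> R by rewrite ltr0n.
rewrite /window -(ler_pM2l M0) -[X in _ && X](ltr_pM2l M0) -!natrM mulrA.
set t := _ * rcoord j x => /andP[h1 h2].
have t0 : 0 <= t by apply: le_trans h1; rewrite ler0n.
have /andP[k1 k2] := truncn_itv t0.
have am : (a * M.+1 <= Num.truncn t)%N.
  by rewrite mulnC -ltnS -(ltr_nat R) (le_lt_trans h1).
have lt : (Num.truncn t - a * M.+1 < M.+1)%N.
  rewrite ltn_subLR// addnC -mulSn mulnC -(ltr_nat R); exact: le_lt_trans h2.
by exists (Ordinal lt); rewrite /in_cell /= subnKC// -/t k1 k2.
Qed.

Lemma in_cell_le a j k (m m' : nat) x x' : in_cell a j m x -> in_cell a k m' x' ->
  rcoord j x <= rcoord k x' -> (m <= m')%N.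
Proof.
move=> /andP[h _] /andP[_ h'] le.
have : (a * M.+1 + m)%:R < (a * M.+1 + m').+1%:R :> R.
  apply: le_lt_trans h (le_lt_trans _ h').
  by rewrite ler_wpM2l// mulr_ge0 ?ler0n.
by rewrite ltr_nat; lia.
Qed.

Hypothesis D_gt0 : (0 < D)%N.
Hypothesis sep : forall j k, j != k -> forall z : int,
  D%:R^-1 <= `|(j%:R - k%:R) * r - z%:~R|.

(** The two coordinates differ by [(j - k) * r] modulo 1, which [sep] keeps at least [1/D] away from
    0, whereas values in one window differ by less than [1/D]. *)
Lemma window_inj a j k x : window a j x -> window a k x -> j = k.
Proof.
move=> /andP[h1 h2] /andP[h3 h4]; apply/eqP/negPn/negP => jk.
have D0 : 0 < D%:R :> R by rewrite ltr0n.
have /intrP[z zE] : (rcoord j x - (repr x - j%:R * r)) -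
    (rcoord k x - (repr x - k%:R * r)) \is a Num.int by rewrite rpredB// rcoord_int.
have := sep jk z; rewrite (_ : _ - _ = rcoord k x - rcoord j x); last by rewrite -zE; ring.
rewrite -(ler_pM2l D0) divff ?lt0r_neq0// -(gtr0_norm D0) -normrM mulrBr.
move: h1 h2 h3 h4; rewrite -!natr1.
move: (D%:R * rcoord j x) (D%:R * rcoord k x) => u v h1 h2 h3 h4.
by rewrite leNgt ltr_norml; apply/negP/negPn; lra.
Qed.

Lemma in_cell_label a j (m : 'I_M.+1) x : in_cell a j m x -> label a x = Some (m, j).
Proof.
move=> h; rewrite /label; case: pickP => [[m' j'] /= h'|/(_ (m, j))]; last by rewrite /= h.
have jj : j' = j := window_inj (in_cell_window h') (in_cell_window h).
rewrite jj in h' *; congr (Some (_, _)); apply: val_inj => /=; apply/eqP.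
by rewrite eqn_leq (in_cell_le h' h)// (in_cell_le h h').
Qed.

Lemma label_in_cell a j (m : 'I_M.+1) x : label a x = Some (m, j) -> in_cell a j m x.
Proof. by rewrite /label; case: pickP => // -[m' j'] /= h [<- <-]. Qed.

(** For each colour [j] the [j]th coordinate of [x] selects one family, and different colours select
    different families. Averaging over families therefore sees every point, even where a single
    family does not cover the circle. *)
Lemma count_labels x : (Q.+1 <= \sum_(a < D) isSome (label a x))%N.
Proof.
have D0 : 0 < D%:R :> R by rewrite ltr0n.
have lt (j : colour) : (Num.truncn (D%:R * rcoord j x) < D)%N.
  have /andP[u0 u1] := rcoord_itv r j x.
  have /andP[k1 k2] := truncn_itv (mulr_ge0 (ltW D0) u0).
  rewrite -(ltr_nat R); apply: le_lt_trans k1 _.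
  by rewrite -[ltRHS]mulr1 ltr_pM2l.
have win (j : colour) : window (Num.truncn (D%:R * rcoord j x)) j x.
  have /andP[u0 _] := rcoord_itv r j x.
  exact: truncn_itv (mulr_ge0 (ltW D0) u0).
pose g (j : colour) : 'I_D := Ordinal (lt j).
have gI : injective g.
  move=> j k /(congr1 val) /= E; apply: (window_inj (win j)).
  by rewrite E; exact: win.
rewrite -[leqLHS](card_ord Q.+1) -(card_imset predT gI).
rewrite -sum1_card big_mkcond /=; apply: leq_sum => a _.
case: ifP => // /imsetP[j _ ->] /=.
by have [m /in_cell_label ->] := window_in_cell (win j).
Qed.

Lemma labels_tile a x : (a < D)%N -> D = Q.+1 -> isSome (label a x).
Proof.
move=> aD DQ; have := count_labels x; rewrite -{1}DQ -[in leqLHS](card_ord D) -sum1_card => h.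
suff /forallP/(_ (Ordinal aD)) : [forall a : 'I_D, isSome (label a x)] by [].
apply/negPn/negP; rewrite negb_forall => /existsP[b bN].
move: h; rewrite leqNgt => /negP; apply.
rewrite (bigD1 b)//= [ltnRHS](bigD1 b)//= (negPf bN) add0n add1n ltnS.
by apply: leq_sum => c _; case: isSome.
Qed.

End labels.

Section configurations.
Variables (R : realType) (r : R).
Hypotheses (r_gt0 : 0 < r) (r_le1 : r <= 1).
Variables (D M Q : nat).
Hypothesis D_gt0 : (0 < D)%N.
Local Notation colour := 'I_Q.+1.
Hypothesis sep : forall j k : colour, j != k -> forall z : int,
  D%:R^-1 <= `|(j%:R - k%:R) * r - z%:~R|.
Variables (n : nat) (pts : 'I_n -> circle R).

Definition points : {fset circle R} := [fset pts i | i in 'I_n]%fset.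

Fact mem_points i : pts i \in points.
Proof. exact: in_imfset. Qed.

Definition indexed_point i : points := [` mem_points i]%fset.

Lemma point_surj (x : points) : exists i, x = indexed_point i.
Proof.
have /imfsetP[i _ xi] := valP x; exists i.
exact: val_inj.
Qed.

Local Notation f := (@cyclic_map R points r).

Definition periodic_index i : bool := `[< periodic_point f (indexed_point i) >].

(** Coinciding points are counted once on the left but for every index on the right; the converse
    bound needs [pts] to be injective. *)
Lemma per_le_periodic_index : (per points r <= #|[pred i | periodic_index i]|)%N.
Proof.
apply: leq_trans (leq_image_card indexed_point [pred i | periodic_index i]).
apply: subset_leq_card; apply/fintype.subsetP => x xP; have [i xi] := point_surj x.
rewrite xi; apply: fintype.image_f; move: xP.
by rewrite !inE /periodic_index -xi.
Qed.

Lemma periodic_index_le_per : injective pts ->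
  (#|[pred i | periodic_index i]| <= per points r)%N.
Proof.
move=> ptsI; have pointI : injective indexed_point by move=> i k /(congr1 val) /= /ptsI.
rewrite -(fintype.card_image pointI); apply: subset_leq_card.
by apply/fintype.subsetP => x /fintype.imageP[i]; rewrite !inE => iP ->.
Qed.

Variable a : nat.

Definition labels : {ffun 'I_n -> option ('I_M.+1 * colour)} :=
  [ffun i => label r D M Q a (pts i)].

Local Notation sigma := (reading_order labels).
Local Notation cell i := (label_cell (labels i)).
Local Notation colr i := (label_colour (labels i)).

Lemma labels_in_cell i : isSome (labels i) ->
  in_cell r D M a (colr i) (cell i) (pts i).
Proof.
rewrite ffunE; case E : (label _ _ _ _ _ _) => [[m c]|]//= _.
exact: label_in_cell E.
Qed.

Lemma labels_in_window i : isSome (labels i) -> window r D a (colr i) (pts i).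
Proof.
rewrite ffunE; case E : (label _ _ _ _ _ _) => [[m c]|]//= _.
exact: in_cell_window (label_in_cell E).
Qed.

Lemma window_labels i (j : colour) : window r D a j (pts i) ->
  isSome (labels i) /\ colr i = j.
Proof.
move=> h; rewrite ffunE; have [m /(in_cell_label D_gt0 sep) ->] := window_in_cell M h.
by [].
Qed.

Hypothesis no_collision : ~~ collision labels.

Lemma cell_inj i k : isSome (labels i) -> isSome (labels k) -> cell i = cell k -> i = k.
Proof.
move=> si sk E; apply/eqP/negPn/negP => ik; case/negP: no_collision.
by apply/existsP; exists i; apply/existsP; exists k; rewrite ik si sk E eqxx.
Qed.

Lemma cell_lt_rcoord i k : isSome (labels i) -> isSome (labels k) ->
  (cell i < cell k)%N -> rcoord r (colr i) (pts i) < rcoord r (colr k) (pts k).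
Proof.
move=> si sk; rewrite ltNge; apply: contraL => le; rewrite -leqNgt.
exact: in_cell_le (labels_in_cell sk) (labels_in_cell si) le.
Qed.

Variable src : bool.
Hypothesis src_int : src = false -> Q.+1%:R * r \is a Num.int.

(** Only the passage from colour [Q] to colour 0 is not immediate: a source excludes it, and without
    one [Q.+1 * r] is an integer. *)
Lemma next_int (c c' : colour) : c' = c + next_colour Q -> ~~ (src && (c' == 0)) ->
  c.+1%:R * r - c'%:R * r \is a Num.int.
Proof.
move=> ->; have -> : c + next_colour Q = inZp c.+1 by rewrite inZpS valZpK.
have := ltn_ord c; rewrite ltnS leq_eqVlt => /predU1P[cQ|cQ] /= ns.
  have e0 : inZp c.+1 = 0 :> colour by apply: val_inj; rewrite /= cQ modnn.
  move: ns; rewrite e0 eqxx andbT => /negbTE /src_int.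
  by rewrite cQ modnn mul0r subr0.
by rewrite modn_small// subrr rpred0.
Qed.

(** This supplies the hypothesis of [count_le_hits]. The point [m] is a periodic preimage of [i]; as
    soon as a point of the colour of [i] has been read earlier, [rcoord_pred] places [m] between
    that point and [i]. *)
Lemma periodic_index_prev i : isSome (labels i) -> periodic_index i ->
  [\/ src && (colr i == 0),
      forall k, k \in sigma -> (cell i < cell k)%N -> colr k != colr i |
      exists m, [/\ m \in sigma, periodic_index m, colr m = colr i - next_colour Q,
        (cell i < cell m)%N & forall k, k \in sigma -> colr k = colr i ->
          (cell i < cell k)%N -> (cell m <= cell k)%N]].
Proof.
move=> si /asboolP iP; have [|ns] := boolP (src && (colr i == 0)); first by constructor 1.
have [[k [ks ik kc]]|h] := pselect (exists k,
   [/\ k \in sigma, (cell i < cell k)%N & colr k = colr i]); last first.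
  constructor 2 => k ks ik; apply/eqP => kc; exact: h (ex_intro _ k (And3 ks ik kc)).
constructor 3; have [y yP fy] := periodic_pred iP; have [m ym] := point_surj y.
rewrite mem_reading_order in ks.
have rel : (colr i - next_colour Q)%R.+1%:R * r - (colr i)%:R * r \is a Num.int.
  by apply: next_int => //; rewrite subrK.
have pred k' : isSome (labels k') -> (cell i < cell k')%N -> colr k' = colr i ->
    rcoord r (colr i) (pts i) < rcoord r (colr i - next_colour Q)%R (pts m)
      <= rcoord r (colr i) (pts k').
  move=> sk' ik' kc'; apply: (rcoord_pred r_le1 rel).
  - by have := cyclic_map_lt r_gt0 y; rewrite fy ym.
  - by have := @cyclic_map_max _ _ _ r_gt0 y (indexed_point k'); rewrite fy ym.
  - by have := cell_lt_rcoord si sk' ik'; rewrite kc'.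
have /andP[im mk] := pred k ks ik kc.
(* The position of [m] is squeezed between two positions in the same window, so [m] carries the
   preceding colour. *)
have wm : window r D a (colr i - next_colour Q)%R (pts m).
  have /andP[h1 _] := labels_in_window si.
  have /andP[_ h2] := labels_in_window ks.
  have D0 : 0 <= D%:R :> R by rewrite ler0n.
  apply/andP; split; first by apply: le_trans h1 _; rewrite ler_wpM2l// ltW.
  by apply: le_lt_trans h2; rewrite kc ler_wpM2l.
have [sm cm] := window_labels wm.
exists m; rewrite mem_reading_order; split=> //.
- by apply/asboolP; rewrite -ym.
(* Equal cells would force [m = i], against the strict inequality of the coordinates. *)
- have : (cell i <= cell m)%N.
    by apply: in_cell_le (labels_in_cell si) (labels_in_cell sm) _; rewrite cm ltW.
  rewrite leq_eqVlt => /predU1P[/(cell_inj si sm) E|//].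
  by move: im; rewrite -E in cm *; rewrite -cm ltxx.
- move=> k'; rewrite mem_reading_order => sk' kc' ik'.
  have /andP[_ mk'] := pred k' sk' ik' kc'.
  by apply: in_cell_le (labels_in_cell sm) (labels_in_cell sk') _; rewrite cm kc'.
Qed.

Lemma labelled_periodic_le_hits :
  (#|[pred i | isSome (labels i) && periodic_index i]| <=
   (foldl (read src) (fun=> true, 0) [seq colr i | i <- sigma]).2)%N.
Proof.
rewrite -count_reading_order.
apply: (count_le_hits (cell := fun i => cell i)); first exact: pairwise_reading_order.
by move=> i; rewrite mem_reading_order; exact: periodic_index_prev.
Qed.

End configurations.

(** * The lower bound when the arcs tile the circle *)

Section tiling.
Variables (R : realType) (r : R).
Hypotheses (r_gt0 : 0 < r) (r_le1 : r <= 1).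
Variables (M Q : nat).
Local Notation colour := 'I_Q.+1.
Hypothesis sep : forall j k : colour, j != k -> forall z : int,
  Q.+1%:R^-1 <= `|(j%:R - k%:R) * r - z%:~R|.
Hypothesis r_int : Q.+1%:R * r \is a Num.int.
Variables (n : nat) (pts : 'I_n -> circle R).
Hypothesis n_gt0 : (0 < n)%N.
Local Notation y := (labels r Q.+1 M Q pts 0).
Hypothesis no_collision : ~~ collision y.

Lemma walk_le_per :
  (foldl (@walk Q) 0 [seq label_colour (y i) | i <- reading_order y] <=
   Q + per (points pts) r)%N.
Proof.
have some i : isSome (y i) by rewrite ffunE; exact: labels_tile.
have r_ge : Q.+1%:R^-1 <= r.
  have Q0 : 0 < Q.+1%:R :> R by rewrite ltr0n.
  have /intrP[z zE] := r_int.
  rewrite -(ler_pM2l Q0) divff ?lt0r_neq0// zE ler1z.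
  have : (0 : R) < z%:~R by rewrite -zE mulr_gt0.
  by rewrite ltr0z; lia.
have ptsI : injective pts.
  move=> i k E; apply: (cell_inj no_collision) => //.
  by rewrite !ffunE E.
have [i0 i0P] : exists i, periodic_index r pts i.
  have [x xP] := periodic_exists r (indexed_point pts (Ordinal n_gt0)).
  have [i xi] := point_surj x.
  by exists i; apply/asboolP; rewrite -xi.
(* The first periodic point read. A periodic predecessor would lie in a higher cell, so
   [periodic_index_prev] leaves only the case that [z] is the first point of its colour. *)
pose z := [arg max_(i > i0 | periodic_index r pts i) label_cell (y i)]%N.
have [zP zmax] : periodic_index r pts z /\
    forall i, periodic_index r pts i -> (label_cell (y i) <= label_cell (y z))%N.
  by rewrite /z; case: arg_maxnP.
apply: leq_trans (_ : Q + count (periodic_index r pts) (reading_order y) <= _)%N.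
  have zs : z \in reading_order y by rewrite mem_reading_order.
  apply: (foldl_walk_le_count (pairwise_reading_order no_collision) zs zP).
  - have [//|//|[m [_ mP _ zm _]]] := periodic_index_prev (src := false) r_gt0 r_le1
      (ltn0Sn Q) sep no_collision (fun=> r_int) (some z) zP.
    by have := zmax m mP; rewrite leqNgt zm.
  (* With [l] the image of [i], [rcoord_succ] puts [l] between [k] and [i] with the colour of [k].
     As [k] is the first such point after [i], it equals [l] and is periodic. *)
  move=> i k _ /asboolP iP _ ki kc between.
  have rel : (label_colour (y i)).+1%:R * r - (label_colour (y k))%:R * r \is a Num.int.
    by apply: (next_int (src := false)).
  have lt := cell_lt_rcoord (some k) (some i) ki.
  have [l fl] := point_surj (cyclic_map r (indexed_point pts i)).
  have := @rcoord_succ R r r_gt0 r_le1 _ _ rel (pts i) (pts k) (pts l).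
  have := cyclic_map_lt r_gt0 (indexed_point pts i); rewrite fl => -> /(_ isT).
  have := @cyclic_map_max _ _ _ r_gt0 (indexed_point pts i) (indexed_point pts k); rewrite fl => h.
  move=> /(_ h lt); set t := rcoord r _ (pts i) in lt *.
  set t' := rcoord r _ (pts k) in lt *.
  (* In family 0 positions are below [1 / Q.+1], hence below [r], so [k] is within reach of [i]. *)
  have ti : t < r.
    have /andP[_] := labels_in_window (some i).
    rewrite -/t => tQ; apply: lt_le_trans r_ge.
    by rewrite -(ltr_pM2l (_ : 0 < Q.+1%:R :> R)) ?ltr0n// divff ?pnatr_eq0.
  have t'0 : 0 <= t' by have /andP[] := rcoord_itv r (label_colour (y k)) (pts k).
  have -> : t - t' < r by apply: le_lt_trans ti; rewrite gerBl.
  move=> /(_ isT) /andP[kl li].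
  have wl : window r Q.+1 0 (label_colour (y k)) (pts l).
    have /andP[_ h2] := labels_in_window (some i).
    have Q0 : 0 <= Q.+1%:R :> R by rewrite ler0n.
    apply/andP; split; last by apply: le_lt_trans h2; rewrite ler_wpM2l// ltW.
    by rewrite mulr_ge0// (le_trans t'0).
  have [sl cl] := window_labels M (ltn0Sn Q) sep wl.
  have lk : (label_cell (y k) <= label_cell (y l))%N.
    by apply: in_cell_le (labels_in_cell (some k)) (labels_in_cell (some l)) _; rewrite cl.
  have lP : periodic_index r pts l.
    by apply/asboolP; rewrite -fl; exact: periodic_cyclic_map.
  have li' : (label_cell (y l) < label_cell (y i))%N.
    have : (label_cell (y l) <= label_cell (y i))%N.
      by apply: in_cell_le (labels_in_cell (some l)) (labels_in_cell (some i)) _; rewrite cl ltW.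
    rewrite leq_eqVlt => /predU1P[/(cell_inj no_collision sl (some i)) E|//].
    by move: li; rewrite -cl E ltxx.
  suff -> : k = l by [].
  apply: (cell_inj no_collision) => //; apply/eqP; rewrite eqn_leq lk /=.
  by apply: between => //; rewrite mem_reading_order.
rewrite leq_add2l count_reading_order.
apply: leq_trans (periodic_index_le_per _ ptsI); apply: subset_leq_card.
apply/fintype.subsetP => i; rewrite !inE => /andP[_].
exact: asboolW.
Qed.

End tiling.

(** * The law of the labels *)

Section uniform_arcs.
Variable R : realType.
Local Notation mu := (@lebesgue_measure R).

(** The preimage in the line of the arc from [c + al] to [c + be]. *)
Definition periodic_arc (c al be : R) : set R :=
  \bigcup_(k : int) [set` `[c + k%:~R + al, c + k%:~R + be[].

Lemma measurable_periodic_arc c al be : measurable (periodic_arc c al be).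
Proof. by apply: countable_bigcupT_measurable => [|k]; [exact: countableP|exact: measurable_itv]. Qed.

Lemma periodic_arc_floor c al be :
  periodic_arc c al be = periodic_arc (c - (Num.floor c)%:~R) al be.
Proof.
apply/seteqP; split => t [k _] /=; rewrite in_itv /= => h.
  by exists (k + Num.floor c) => //=; rewrite in_itv /= intrD; move: h; congr (_ && _); congr (_ _ _); ring.
by exists (k - Num.floor c) => //=; rewrite in_itv /= intrB; move: h; congr (_ && _); congr (_ _ _); ring.
Qed.

(** Only the translates by 0 and by -1 meet the unit interval; [min] and [max] truncate them. *)
Lemma periodic_arc_unit c al be : 0 <= c < 1 -> 0 <= al -> al <= be -> be <= 1 ->
  periodic_arc c al be `&` `[0, 1[ =
  `[Num.min 1 (c + al), Num.min 1 (c + be)[ `|`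
  `[Num.max 0 (c - 1 + al), Num.max 0 (c - 1 + be)[.
Proof.
move=> /andP[c0 c1] al0 albe be1; apply/seteqP; split => t /=.
  move=> [[k _]] /=; rewrite !in_itv /= => /andP[h1 h2] /andP[t0 t1].
  have [k0|k0] := lerP 0 k.
    have k00 : k = 0.
      have : k%:~R < 1%:~R :> R by lra.
      by rewrite ltr_int; lia.
    move: h1 h2; rewrite k00 addr0 => h1 h2; left.
    by rewrite ge_min lt_min t1 h1 h2 orbT.
  have km1 : k = -1.
    have : (-2)%:~R < k%:~R :> R by lra.
    have := k0; rewrite ltr_int; lia.
  move: h1 h2; rewrite km1 => h1 h2; right.
  by rewrite ge_max lt_max t0 h1 h2 orbT.
rewrite !in_itv /= => -[|].
  rewrite ge_min lt_min => /andP[h1 /andP[t1 h2]].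
  have {}h1 : c + al <= t by move: h1; rewrite leNgt t1.
  split; first by exists 0 => //=; rewrite in_itv /= addr0 h1 h2.
  by rewrite t1 andbT; lra.
rewrite ge_max lt_max => /andP[/andP[t0 h1] h2].
have {}h2 : t < c - 1 + be by move: h2; rewrite ltNge t0.
split; first by exists (-1) => //=; rewrite in_itv /= h1 h2.
by rewrite t0; lra.
Qed.

Lemma lebesgue_itvco (x y : R) : x <= y -> mu `[x, y[ = (y - x)%:E.
Proof.
move=> xy; rewrite lebesgue_measure_itv /= lte_fin.
by have [->|xNy] := eqVneq x y; [rewrite ltxx subrr|rewrite lt_neqAle xNy xy].
Qed.

Lemma uniform_periodic_arc c al be : 0 <= al -> al <= be -> be <= 1 ->
  uniform_prob (@ltr01 R) (periodic_arc c al be) = (be - al)%:E.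
Proof.
move=> al0 albe be1; rewrite periodic_arc_floor.
have := floor_itv c; rewrite intrD; set c' := c - _ => c01.
have {c01} c01 : 0 <= c' < 1 by rewrite /c'; lra.
have mA := measurable_periodic_arc c' al be.
rewrite /uniform_prob integral_uniform_pdf.
rewrite (eq_integral (cst 1%E)); last first.
  move=> x; rewrite inE /= in_itv /= => -[_ x01].
  by rewrite /uniform_pdf x01 subr0 invr1.
rewrite integral_cst ?mul1e; last exact: measurableI.
(* The uniform density lives on the closed interval; the endpoint 1 is split off as a null set. *)
have -> : periodic_arc c' al be `&` `[0, 1] =
    (periodic_arc c' al be `&` `[0, 1[) `|` (periodic_arc c' al be `&` [set 1]).
  rewrite -setIUr; congr (_ `&` _); apply/seteqP; split => t /=; rewrite !in_itv /=.
    move=> /andP[t0]; rewrite le_eqVlt => /predU1P[->|t1]; first by right.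
    by left; rewrite t0.
  by move=> [/andP[-> /ltW]//|->]; rewrite ler01 lexx.
rewrite measureU0; [|exact: measurableI|exact: measurableI|]; last first.
  apply/eqP; rewrite eq_le measure_ge0 andbT.
  rewrite -(lebesgue_measure_set1 (1 : R)); apply: le_measure; rewrite ?inE//.
  exact: measurableI.
rewrite periodic_arc_unit// measureU//=; last first.
  apply/seteqP; split => // t [] /=; rewrite !in_itv /= => /andP[h1 h2] /andP[_ h4].
  move: c01 => /andP[c0 c1]; move: h1 h2 h4; rewrite ge_min lt_min lt_max.
  by move=> /orP[?|?] /andP[? ?] /orP[?|?]; lra.
move: c01 => /andP[c0 c1]; rewrite !lebesgue_itvco.
- rewrite -EFinD; congr (_%:E); rewrite /Num.min /Num.max.
  by do 4 (case: ltrP => ?); lra.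
- by rewrite /Num.max; do 2 (case: ltrP => ?); lra.
- by rewrite /Num.min; do 2 (case: ltrP => ?); lra.
Qed.

End uniform_arcs.

(** * Integrals of finite-valued random variables *)

Section integrals.
Context d (T : measurableType d) (R : realType) (P : probability T R).

Lemma integral_finite_valued (Z : finType) (Y : T -> Z) (F : Z -> R) :
  (forall z, measurable (Y @^-1` [set z])) -> (forall z, 0 <= F z) ->
  (\int[P]_t (F (Y t))%:E = \sum_z (F z)%:E * P (Y @^-1` [set z]))%E.
Proof.
move=> mY F0.
transitivity (\int[P]_t (\sum_z (F z)%:E * (\1_(Y @^-1` [set z]) t)%:E))%E.
  apply: eq_integral => t _; rewrite (bigD1 (Y t))//= big1 => [|z zY].
    by rewrite adde0 indicE mem_set ?mule1.
  rewrite indicE memNset ?mule0//= => E.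
  by rewrite E eqxx in zY.
rewrite ge0_integral_sum//.
- apply: eq_bigr => z _; rewrite ge0_integralZl_EFin//.
    by rewrite integral_indic// setIT.
  exact/measurable_EFinP/measurable_indic.
- move=> z; apply: measurable_funeM.
  exact/measurable_EFinP/measurable_indic.
- by move=> z t _; rewrite mule_ge0// lee_fin.
Qed.

Lemma measurable_finite_valued (Z : finType) (Y : T -> Z) (F : Z -> R) :
  (forall z, measurable (Y @^-1` [set z])) ->
  measurable_fun setT (fun t => (F (Y t))%:E).
Proof.
move=> mY _ B _; rewrite setTI.
rewrite (_ : _ @^-1` _ = \bigcup_(z in [set z | B (F z)%:E]) Y @^-1` [set z]).
  by apply: fin_bigcup_measurable.
by apply/seteqP; split => t /= => [h|[z /= h ->]//]; exists (Y t).
Qed.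

(* Measurability of [f] and [g] is not assumed, because [per] is not shown to be
   measurable: the integral of a nonnegative function is by definition a supremum
   over simple functions. *)
Lemma ge0_le_integral_nonmeasurable (f g : T -> \bar R) :
  (forall t, 0 <= f t)%E -> (forall t, f t <= g t)%E ->
  (\int[P]_t f t <= \int[P]_t g t)%E.
Proof.
move=> f0 fg; rewrite !ge0_integralTE//; last first.
  by move=> t; exact: le_trans (fg t).
apply: le_ereal_sup => _ [h hf <-]; exists h => // t.
exact: le_trans (fg t).
Qed.

End integrals.

Section label_law.
Variables (R : realType) (r : R) (D M Q : nat).
Local Notation colour := 'I_Q.+1.
Hypothesis D_gt0 : (0 < D)%N.
Hypothesis sep : forall j k : colour, j != k -> forall z : int,
  D%:R^-1 <= `|(j%:R - k%:R) * r - z%:~R|.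
Variable a : nat.
Hypothesis aD : (a < D)%N.
Local Notation N := (M.+1%:R * D%:R : R).

Lemma cell_end_le1 (m : 'I_M.+1) : (a * M.+1 + m).+1%:R / N <= 1.
Proof.
have N0 : 0 < N by rewrite mulr_gt0 ?ltr0n.
rewrite ler_pdivrMr// mul1r -natrM ler_nat.
apply: leq_trans (_ : a.+1 * M.+1 <= _)%N; first by have := ltn_ord m; lia.
by rewrite mulnC leq_mul2l aD orbT.
Qed.

Lemma in_cell_arc j (m : 'I_M.+1) :
  @to_circle R @^-1` [set x | in_cell r D M a j m x] =
  periodic_arc (j%:R * r) ((a * M.+1 + m)%:R / N) ((a * M.+1 + m).+1%:R / N).
Proof.
have N0 : 0 < N by rewrite mulr_gt0 ?ltr0n.
have b1 := cell_end_le1 m.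
have a0 : 0 <= (a * M.+1 + m)%:R / N by rewrite divr_ge0// ltW.
have cellE x : in_cell r D M a j m x =
    ((a * M.+1 + m)%:R / N <= rcoord r j x < (a * M.+1 + m).+1%:R / N).
  by rewrite /in_cell ler_pdivrMr// ltr_pdivlMr// ![_ * N]mulrC.
move: ((a * M.+1 + m)%:R / N) ((a * M.+1 + m).+1%:R / N) a0 b1 cellE.
move=> al be a0 b1 cellE; apply/seteqP; split => t /=; rewrite cellE.
  rewrite /rcoord cdistE => /andP[h1 h2].
  exists (Num.floor (t - j%:R * r)) => //=; rewrite in_itv /=.
  by apply/andP; split; lra.
move=> [k _] /=; rewrite in_itv /= => /andP[h1 h2].
have -> : rcoord r j (to_circle t) = t - j%:R * r - k%:~R.
  apply: int_sub_eq; [exact: rcoord_itv|lra|].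
  rewrite /rcoord cdistE opprB addrC addrA subrK -intrB.
  exact: intr_int.
by apply/andP; split; lra.
Qed.

Lemma measurable_in_cell j (m : 'I_M.+1) :
  measurable [set x : circle R | in_cell r D M a j m x].
Proof.
change (measurable (@to_circle R @^-1` [set x | in_cell r D M a j m x])).
by rewrite in_cell_arc; exact: measurable_periodic_arc.
Qed.

Lemma circle_uniform_in_cell j (m : 'I_M.+1) :
  circle_uniform [set x : circle R | in_cell r D M a j m x] = (N^-1)%:E.
Proof.
have N0 : 0 < N by rewrite mulr_gt0 ?ltr0n.
rewrite /circle_uniform /pushforward in_cell_arc uniform_periodic_arc.
- by rewrite -mulrBl -natr1 addrAC subrr add0r mul1r.
- by rewrite divr_ge0// ltW.
- by rewrite ler_pM2r ?invr_gt0// ler_nat.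
- exact: cell_end_le1.
Qed.

Local Notation lab := (@label R r D M Q a).

Lemma label_fiber_some m j : [set x | lab x = Some (m, j)] =
  [set x | in_cell r D M a j m x].
Proof.
apply/seteqP; split => x /=; first exact: label_in_cell.
exact: in_cell_label.
Qed.

Lemma measurable_label_fiber z : measurable [set x | lab x = z].
Proof.
have mS mj : measurable [set x | lab x = Some mj].
  by case: mj => m j; rewrite label_fiber_some; exact: measurable_in_cell.
case: z => [mj|]; first exact: mS.
rewrite (_ : [set _ | _] = ~` \bigcup_(mj : 'I_M.+1 * colour) [set x | lab x = Some mj]).
  by apply: measurableC; apply: countable_bigcupT_measurable => //; exact: countableP.
apply/seteqP; split => x /= => [E [mj _] /=|h]; first by rewrite E.
by case E : (lab x) => [mj|] //; case: h; exists mj.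
Qed.

Context d (T : measurableType d) (P : probability T R).

Lemma label_law (X : {RV P >-> circle R}) z : uniform_on_circle X ->
  P (X @^-1` [set x | lab x = z]) = (label_weight N^-1 z)%:E.
Proof.
move=> hX.
have PX A : measurable A -> P (X @^-1` A) = circle_uniform A by exact: hX.
have some mj : P (X @^-1` [set x | lab x = Some mj]) = (N^-1)%:E.
  case: mj => m j; rewrite PX ?label_fiber_some ?circle_uniform_in_cell//.
  exact: measurable_in_cell.
case: z => [mj|]; first exact: some.
have mlab z : measurable ((lab \o X) @^-1` [set z]).
  exact: (@measurable_funPTI _ _ _ _ X _ (measurable_label_fiber z)).
(* With the constant 1, this says that the fibres have total probability 1, which determines the
   probability of [None]. *)
have := integral_finite_valued P mlab (fun=> ler01).
rewrite integral_cst//= mul1e probability_setT (bigD1 None)//= mul1e.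
rewrite (reindex_onto Some (odflt (ord0, 0))) /=; last by case.
rewrite (eq_bigl predT); last by move=> mj; rewrite /= eqxx.
rewrite (eq_bigr (fun=> (N^-1)%:E)); last by move=> mj _; rewrite mul1e; exact: some.
rewrite sumEFin sumr_const card_prod !card_ord => /esym E.
set p := P _ in E *; have pf : p \is a fin_num by exact: fin_num_measure.
rewrite -(fineK pf) -EFinD in E *; case: E => E; congr (_%:E).
rewrite -[LHS](addrK (N^-1 *+ (M.+1 * Q.+1))) E /=; congr (1 - _).
by rewrite -[LHS]mulr_natl natrM.
Qed.

Section independent_labels.
Variables (n : nat) (X : 'I_n -> {RV P >-> circle R}).
Local Notation Y := (fun t => labels r D M Q (fun i => X i t) a).

Lemma labels_fiber y : Y @^-1` [set y] =
  \bigcap_(i in [set` [set: 'I_n]%SET]) X i @^-1` [set x | lab x = y i].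
Proof.
apply/seteqP; split => t /= => [<- i _|h]; first by rewrite /= ffunE.
by apply/ffunP => i; rewrite ffunE; apply: h; rewrite /= inE.
Qed.

Lemma measurable_labels_fiber y : measurable (Y @^-1` [set y]).
Proof.
rewrite labels_fiber; apply: fin_bigcap_measurable => [|i _]; first exact: finite_finset.
exact: measurable_funPTI (measurable_label_fiber (y i)).
Qed.

Lemma labels_law (F : {ffun 'I_n -> _} -> R) :
  (forall i, uniform_on_circle (X i)) -> mutually_independent X ->
  (forall y, 0 <= F y) ->
  (\int[P]_t (F (Y t))%:E = (pmean (label_weight N^-1) F)%:E)%E.
Proof.
move=> hX indep F0.
rewrite (integral_finite_valued P measurable_labels_fiber F0) /pmean -sumEFin.
apply: eq_bigr => y _; rewrite labels_fiber (indep _ (fun i => [set x | lab x = y i])); last first.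
  by move=> i; exact: measurable_label_fiber.
rewrite muleC EFinM; congr (_ * _)%E.
rewrite (big_morph EFin EFinM erefl); apply: eq_big => [i|i _]; first by rewrite inE.
exact: label_law.
Qed.

End independent_labels.

End label_law.

(** * Bounds on the mean number of periodic points *)

Section mean_bounds.
Variables (R : realType) (r : R).
Hypotheses (r_gt0 : 0 < r) (r_le1 : r <= 1).
Variables (D Q : nat).
Local Notation colour := 'I_Q.+1.
Hypothesis QD : (Q.+1 <= D)%N.
Hypothesis sep : forall j k : colour, j != k -> forall z : int,
  D%:R^-1 <= `|(j%:R - k%:R) * r - z%:~R|.
Context d (T : measurableType d) (P : probability T R).
Variables (n : nat) (X : 'I_n -> {RV P >-> circle R}).
Hypotheses (hX : forall i, uniform_on_circle (X i)) (indep : mutually_independent X).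

Let D_gt0 : (0 < D)%N. Proof. exact: leq_trans QD. Qed.

(* Two points collide with probability at most [n^2 / M.+1], at a cost of at most
   [n]; hence [n^3] cells per arc. *)
Local Notation M := (n ^ 3)%N.
Local Notation label_type := (option ('I_M.+1 * colour)).
Local Notation w := ((M.+1%:R * D%:R)^-1 : R).
Local Notation mean := (pmean (n := n) (label_weight (M := M) (Q := Q) w)).
Local Notation Y a t := (labels r D M Q (fun i => X i t) a).

Let w_ge0 : 0 <= w. Proof. by rewrite invr_ge0 mulr_ge0. Qed.

Let w_cells : M.+1%:R * Q.+1%:R * w = Q.+1%:R / D%:R.
Proof.
have M0 : M.+1%:R != 0 :> R by rewrite pnatr_eq0.
have D0 : D%:R != 0 :> R by rewrite pnatr_eq0 -lt0n.
by move: (M.+1%:R : R) (D%:R : R) M0 D0 => m x m0 x0; field; rewrite m0 x0.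
Qed.

Let w_le : M.+1%:R * Q.+1%:R * w <= 1.
Proof. by rewrite w_cells ler_pdivrMr ?ltr0n// mul1r ler_nat. Qed.

Let mean_collision : mean (fun y => n%:R * (collision y)%:R) <= 1.
Proof.
rewrite pmeanZ; have wle : Q.+1%:R * M.+1%:R * w <= 1 by rewrite [X in X * _]mulrC.
apply: le_trans (ler_wpM2l (ler0n _ n) (mean_collision_le n w_ge0 w_le wle)) _.
rewrite mulrA -exprS ler_pdivrMr ?ltr0n// mul1r -natrX ler_nat.
exact: leqnSn.
Qed.

(** By [count_labels], [Q.+1] times the number of periodic points is at most the number of labelled
    periodic points summed over the [D] families. Each family contributes at most its hits, or [n]
    if there is a collision. The additive constant does not depend on [n]. *)
Lemma mean_per_le (src : bool) G :
  (src = false -> Q.+1%:R * r \is a Num.int) -> (0 < G <= Q.+1)%N ->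
  (\int[P]_t ((per (points (fun i => X i t)) r)%:R)%:E <=
   (hit_rate R Q src G * n%:R + D%:R * (G%:R * Q.+1%:R + 1) / Q.+1%:R)%:E)%E.
Proof.
move=> src_int GQ.
pose hits (y : {ffun 'I_n -> label_type}) := (foldl (read src) (fun=> true, 0%N)
  [seq label_colour (y i) | i <- reading_order y]).2.
pose F (y : {ffun 'I_n -> label_type}) : R :=
  Q.+1%:R^-1 * ((hits y)%:R + n%:R * (collision y)%:R).
have F0 y : 0 <= F y by rewrite /F mulr_ge0 ?invr_ge0 ?addr_ge0 ?mulr_ge0.
have perF t : (per (points (fun i => X i t)) r)%:R <= \sum_(a < D) F (Y a t).
  rewrite /F -mulr_sumr mulrC ler_pdivlMr ?ltr0n// -natrM.
  pose B := periodic_index r (fun i => X i t).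
  apply: le_trans (_ : (\sum_(a < D) #|[pred i | isSome (Y a t i) && B i]|)%:R <= _).
    rewrite ler_nat; apply: leq_trans (_ : #|[pred i | B i]| * Q.+1 <= _)%N.
      by rewrite leq_mul2r per_le_periodic_index orbT.
    rewrite -sum1_card big_distrl /=.
    under [leqRHS]eq_bigr => a _ do rewrite -sum1_card big_mkcond /=.
    rewrite exchange_big /= big_mkcond; apply: leq_sum => i _; rewrite inE mul1n.
    case: ifP => // Bi; apply: leq_trans (count_labels M D_gt0 sep (X i t)) _.
    apply: leq_sum => a _; rewrite inE Bi andbT ffunE.
    by case: (label _ _ _ _ _ _).
  rewrite natr_sum; apply: ler_sum => a _.
  have [c|c] := boolP (collision (Y a t)).
    rewrite mulr1 -[leLHS]add0r lerD// ler_nat.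
    by apply: leq_trans (max_card _) _; rewrite card_ord.
  rewrite mulr0 addr0 ler_nat.
  exact: (labelled_periodic_le_hits r_gt0 r_le1 D_gt0 sep c src_int).
apply: (@le_trans _ _ (\int[P]_t (\sum_(a < D) (F (Y a t))%:E))%E).
  apply: ge0_le_integral_nonmeasurable => t; first by rewrite lee_fin.
  by rewrite sumEFin lee_fin perF.
rewrite ge0_integral_sum//; last 2 first.
- move=> a; apply: (measurable_finite_valued (Y := fun t => Y a t)).
  exact: measurable_labels_fiber.
- by move=> a t _; rewrite lee_fin.
rewrite (eq_bigr (fun=> (mean F)%:E)); last first.
  by move=> a _; exact: (labels_law D_gt0 sep (ltn_ord a) hX indep F0).
rewrite sumEFin lee_fin sumr_const card_ord.
rewrite pmeanZ pmeanD -[leLHS]mulr_natl.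
have h1 := mean_hits_le n w_ge0 w_le src GQ.
have h2 : mean (fun y => (hits y)%:R) + mean (fun y => n%:R * (collision y)%:R) <=
   hit_rate R Q src G * (n%:R * (Q.+1%:R / D%:R)) + G%:R * Q.+1%:R + 1.
  by rewrite -w_cells; exact: lerD h1 mean_collision.
apply: le_trans (ler_wpM2l _ (ler_wpM2l _ h2)) _; rewrite ?invr_ge0 ?ler0n//.
rewrite le_eqVlt; apply/orP; left; apply/eqP; field.
by rewrite nat1r !pnatr_eq0 /= -lt0n ?andbT D_gt0.
Qed.

Lemma foldl_walk_le_size x (l : seq colour) : (foldl (@walk Q) x l <= x + size l)%N.
Proof.
elim: l x => [|c l IH] x /=; first by rewrite addn0.
by apply: leq_trans (IH _) _; rewrite /walk; case: ifP => _; lia.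
Qed.

Lemma mean_per_ge : D = Q.+1 -> Q.+1%:R * r \is a Num.int -> (0 < n)%N ->
  ((n%:R / Q.+1%:R - (Q%:R + 1))%:E <=
   \int[P]_t ((per (points (fun i => X i t)) r)%:R)%:E)%E.
Proof.
move=> DQ r_int n_gt0.
pose V (y : {ffun 'I_n -> label_type}) : R := (foldl (@walk Q) 0%N
  [seq label_colour (y i) | i <- reading_order y])%:R.
(* Truncation at 0 makes [F] nonnegative, as the comparison of integrals requires. On a collision
   [F] vanishes, because the walk gains at most [n]. *)
pose F (y : {ffun 'I_n -> label_type}) : R :=
  Num.max 0 (V y - (Q%:R + n%:R * (collision y)%:R)).
have F0 y : 0 <= F y by rewrite /F le_max lexx.
have perF t : F (Y 0 t) <= (per (points (fun i => X i t)) r)%:R.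
  rewrite /F ge_max ler0n /= lerBlDr.
  have [c|c] := boolP (collision (Y 0 t)).
    rewrite mulr1 -!natrD ler_nat /V.
    apply: leq_trans (foldl_walk_le_size _ _) _; rewrite add0n size_map.
    have : (size (reading_order (Y 0 t)) <= n)%N.
      rewrite -[X in (_ <= X)%N](card_ord n) -(card_uniqP (uniq_reading_order _)).
      exact: max_card.
    by move=> h; apply: leq_trans h _; rewrite addnA leq_addl.
  rewrite mulr0 addr0 -natrD ler_nat addnC.
  have walk_le D' : D' = Q.+1 -> (forall j k : colour, j != k -> forall z : int,
      D'%:R^-1 <= `|(j%:R - k%:R) * r - z%:~R|) ->
      ~~ collision (labels r D' M Q (fun i => X i t) 0) ->
      (foldl (@walk Q) 0 [seq label_colour (labels r D' M Q (fun i => X i t) 0 i) |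
        i <- reading_order (labels r D' M Q (fun i => X i t) 0)] <=
       Q + per (points (fun i => X i t)) r)%N.
    by move=> -> sepQ c'; exact: walk_le_per.
  exact: walk_le.
apply: (@le_trans _ _ (\int[P]_t (F (Y 0 t))%:E)%E); last first.
  by apply: ge0_le_integral_nonmeasurable => t; rewrite lee_fin.
rewrite (labels_law D_gt0 sep D_gt0 hX indep F0) lee_fin.
have mD : n%:R / Q.+1%:R <= mean V.
  apply: le_trans (mean_walk_ge n w_ge0 w_le).
  rewrite DQ le_eqVlt; apply/orP; left; apply/eqP.
  have M0 : M.+1%:R != 0 :> R by rewrite pnatr_eq0.
  by rewrite invfM mulVKf.
have -> : Q%:R = mean (fun=> Q%:R) by rewrite (pmean_cst n (@label_weight_sum R M Q w)).
rewrite lerBlDr.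
apply: le_trans mD _; apply: le_trans (_ : mean F + (mean (fun=> Q%:R) +
  mean (fun y => n%:R * (collision y)%:R)) <= _); last by rewrite !lerD2l.
rewrite -!pmeanD; apply: pmean_le => [z|y]; first exact: label_weight_ge0.
by rewrite -lerBlDr /F le_max lexx orbT.
Qed.

End mean_bounds.

(** * Passage to the limit and separation of the arcs *)

Lemma cvg_ratio (R : realType) (e : nat -> \bar R) (L : R) :
  (forall eps, 0 < eps -> exists C, forall n, (0 < n)%N ->
    (((L - eps) * n%:R - C)%:E <= e n <= ((L + eps) * n%:R + C)%:E)%E) ->
  (e n * (n%:R^-1)%:E)%E @[n --> \oo] --> L%:E.
Proof.
move=> eC; apply/fine_cvgP; split.
  have [C hC] := eC 1 ltr01; near=> n.
  have n0 : (0 < n)%N by near: n; exact: nbhs_infty_gt.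
  have /andP[h1 h2] := hC n n0; rewrite fin_numM// fin_numElt.
  by rewrite (lt_le_trans _ h1) ?ltNyr// (le_lt_trans h2) ?ltry.
apply/cvgrPdist_le => eps eps0.
have e20 : 0 < eps / 2 by rewrite divr_gt0.
have [C hC] := eC _ e20; near=> n.
have n0 : (0 < n)%N by near: n; exact: nbhs_infty_gt.
have nC : C / (eps / 2) <= n%:R by near: n; exact: nbhs_infty_ger.
have {}nC : C <= n%:R * (eps / 2) by rewrite -ler_pdivrMr.
move: (hC n n0) => /=; case: (e n) => [x||] /=; rewrite ?leNye ?leye_eq ?leeNy_eq ?andbF//.
rewrite !lee_fin => /andP[h1 h2].
have nR : 0 < n%:R :> R by rewrite ltr0n.
rewrite ler_distlC; apply/andP; split.
  by rewrite ler_pdivlMr//; lra.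
by rewrite ler_pdivrMr//; lra.
Unshelve. all: by end_near. Qed.

(** The finitely many numbers [(j - k) * r] with [j != k] are not integers, so their distances to
    the nearest integer have a positive minimum. *)
Lemma irrational_separated (R : realType) (r : R) (Q : nat) : irrational r ->
  exists2 D, (Q.+1 <= D)%N & forall j k : 'I_Q.+1, j != k -> forall z : int,
    D%:R^-1 <= `|(j%:R - k%:R) * r - z%:~R|.
Proof.
move=> irr; pose fr (jk : 'I_Q.+1 * 'I_Q.+1) : R :=
  (jk.1%:R - jk.2%:R) * r - (Num.floor ((jk.1%:R - jk.2%:R) * r))%:~R.
pose gap jk := Num.min (fr jk) (1 - fr jk).
(* For [j = k] the gap is 0, whose inverse is 0 by convention, so the diagonal contributes only 1 to
   the maximum. *)
pose D := maxn Q.+1 (\max_jk (Num.truncn (gap jk)^-1).+1).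
exists D; first exact: leq_maxl.
move=> j k jk z; set x := (j%:R - k%:R) * r.
have /andP[f0 f1] : 0 <= fr (j, k) < 1.
  by rewrite /fr /=; have := floor_itv x; rewrite intrD -/x; lra.
have {}f0 : 0 < fr (j, k).
  rewrite lt_neqAle f0 andbT eq_sym; apply/eqP => fr0; apply: irr; apply/rationalP.
  have [jk0|jk0] := ltnP k j.
    exists (Num.floor x), (j - k)%N; apply/eqP; rewrite eq_sym -subr_eq0.
    rewrite natrB ?(ltnW jk0)//.
    have jk1 : j%:R - k%:R != 0 :> R by rewrite subr_eq0 eqr_nat gtn_eqF.
    rewrite (_ : _%:~R = (j%:R - k%:R) * r); first by rewrite mulrC mulKf ?subrr.
    by apply/eqP; rewrite eq_sym -subr_eq0 -/x; apply/eqP.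
  have kj0 : (j < k)%N by rewrite ltn_neqAle jk.
  exists (- Num.floor x), (k - j)%N; apply/eqP; rewrite eq_sym -subr_eq0.
  rewrite natrB ?(ltnW kj0)//.
  have jk1 : k%:R - j%:R != 0 :> R by rewrite subr_eq0 eqr_nat gtn_eqF.
  rewrite mulrNz (_ : _%:~R = (j%:R - k%:R) * r); first by rewrite -mulNr opprB mulrC mulKf ?subrr.
  by apply/eqP; rewrite eq_sym -subr_eq0 -/x; apply/eqP.
have g0 : 0 < gap (j, k) by rewrite /gap lt_min f0 subr_gt0.
apply: le_trans (_ : gap (j, k) <= _).
  rewrite invf_ple ?posrE ?ltr0n ?leq_max//.
  have /andP[_ /ltW h] : (Num.truncn (gap (j, k))^-1)%:R <= (gap (j, k))^-1 <
     (Num.truncn (gap (j, k))^-1).+1%:R by apply: truncn_itv; rewrite invr_ge0 ltW.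
  apply: le_trans h _; rewrite ler_nat leq_max; apply/orP; right.
  exact: (leq_bigmax (F := fun jk => (Num.truncn (gap jk)^-1).+1) (j, k)).
have xE : x = fr (j, k) + (Num.floor x)%:~R by rewrite /fr subrK.
rewrite xE -addrA -intrB /gap.
move: (fr (j, k)) f0 f1 => f f0 f1.
have [h|h] := lerP 0 (Num.floor x - z).
  have : (0 : R) <= (Num.floor x - z)%:~R by rewrite ler0z.
  move: (_%:~R) => y y0; rewrite ge_min ger0_norm ?addr_ge0 ?(ltW f0)//.
  by rewrite lerDl y0.
have : (Num.floor x - z)%:~R <= (-1)%:~R :> R by rewrite ler_int; lia.
move: (_%:~R) => y; rewrite mulrN1z => y0; rewrite ge_min ltr0_norm; last by lra.
by apply/orP; right; lra.
Qed.

(** Over the denominator [q] the numerator is an integer. If it were 0, [q] would divide [j - k] by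
    coprimality, which is impossible for distinct [j] and [k] below [q]. *)
Lemma rational_separated (R : realType) (p q : nat) : coprime p q ->
  forall j k : 'I_q, j != k -> forall z : int,
    q%:R^-1 <= `|(j%:R - k%:R) * (p%:R / q%:R) - z%:~R| :> R.
Proof.
move=> pq j k jk z.
have q0 : (0 < q)%N by apply: leq_ltn_trans (ltn_ord j).
have qR : 0 < q%:R :> R by rewrite ltr0n.
rewrite (_ : _ - _ = ((j%:Z - k%:Z) * p%:Z - z * q%:Z)%:~R / q%:R); last first.
  by rewrite !(intrM, intrB) !pmulrn; field; rewrite lt0r_neq0.
rewrite normrM normfV (gtr0_norm qR) -[leLHS]mul1r ler_pM2r ?invr_gt0//.
rewrite -intr_norm ler1z.
suff : (j%:Z - k%:Z) * p%:Z - z * q%:Z != 0 by lia.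
rewrite subr_eq0; apply: contra_neqN jk => /eqP E.
have : (q %| `|j%:Z - k%:Z|%N)%N.
  have : (q%:Z %| (j%:Z - k%:Z) * p%:Z)%Z by rewrite E dvdz_mull.
  by rewrite dvdzE abszM /= Gauss_dvdl // coprime_sym.
move=> /dvdn_leq; have := ltn_ord j; have := ltn_ord k => hk hj h.
apply: val_inj => /=; lia.
Qed.

Theorem theorem4p6 (R : realType) (r : R) (hr0 : 0 < r) (hr1 : r <= 1)
    (d : nat -> measure_display) (T : forall n : nat, measurableType (d n))
    (P : forall n : nat, probability (T n) R)
    (X : forall n : nat, 'I_n -> {RV (P n) >-> circle R})
    (hunif : forall (n : nat) (i : 'I_n), uniform_on_circle (X n i))
    (hindep : forall n : nat, mutually_independent (X n)) :
  let mean_per_ratio (n : nat) : \bar R :=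
    ('E_(P n)[fun w => (per (point_set (X n) w) r)%:R] * (n%:R^-1)%:E)%E in
  (irrational r -> mean_per_ratio n @[n --> \oo] --> (0 : R)%:E) /\
  (forall p q : nat, (0 < p)%N -> (0 < q)%N -> coprime p q ->
    r = p%:R / q%:R -> mean_per_ratio n @[n --> \oo] --> (q%:R^-1)%:E).
Proof.
move=> mean_per_ratio; split=> [irr|p [//|Q] _ _ pQ rE].
  apply: cvg_ratio => eps eps0.
  (* [G] and then [Q] are chosen so that each of the two terms of [hit_rate] is at most
     [eps / 2]. *)
  pose G := (Num.truncn (2 / eps)).+1.
  pose Q := maxn G (Num.truncn ((1 + G%:R ^+ 2) * (2 / eps))).+1.
  have [D QD sep] := irrational_separated Q irr.
  have Gle : G%:R^-1 <= eps / 2.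
    rewrite -[leRHS]invrK lef_pV2 ?posrE ?invr_gt0 ?divr_gt0// invf_div ltW//.
    by have /andP[] := truncn_itv (ltW (divr_gt0 (ltr0n R 2) eps0)).
  have Qle : (1 + G%:R ^+ 2) / Q.+1%:R <= eps / 2.
    rewrite ler_pdivrMr ?ltr0n// mulrC -ler_pdivrMr ?divr_gt0// invf_div.
    have G0 : 0 <= (1 + G%:R ^+ 2) * (2 / eps) by rewrite mulr_ge0 ?addr_ge0 ?divr_ge0 ?exprn_ge0// ltW.
    have /andP[_ /ltW h] := truncn_itv G0; apply: le_trans h _.
    by rewrite ler_nat leqW// leq_maxr.
  exists (D%:R * (G%:R * Q.+1%:R + 1) / Q.+1%:R) => n n0; rewrite unlock; apply/andP; split.
    apply: (@le_trans _ _ 0%E); last by apply: integral_ge0 => t _; rewrite lee_fin.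
    rewrite lee_fin sub0r mulNr -opprD oppr_le0.
    by rewrite addr_ge0 ?mulr_ge0 ?addr_ge0 ?mulr_ge0 ?invr_ge0// ltW.
  have GQ : (0 < G <= Q.+1)%N by rewrite /= leqW// leq_maxl.
  apply: le_trans (mean_per_le hr0 hr1 QD sep (hunif n) (hindep n) (src := true) _ GQ) _ => //.
  rewrite lee_fin lerD2r ler_wpM2r// /hit_rate mul1r add0r.
  by rewrite [leRHS](splitr eps) lerD.
apply: cvg_ratio => eps eps0.
have Q0 : 0 < Q.+1%:R :> R by rewrite ltr0n.
have r_int : Q.+1%:R * r \is a Num.int by rewrite rE mulrC divfK ?lt0r_neq0.
have sep (j k : 'I_Q.+1) : j != k -> forall z : int,
    Q.+1%:R^-1 <= `|(j%:R - k%:R) * r - z%:~R|.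
  by rewrite rE; exact: rational_separated.
pose C : R := Q.+1%:R * (Q.+1%:R * Q.+1%:R + 1) / Q.+1%:R.
have C0 : 0 <= C by rewrite !mulr_ge0 ?addr_ge0 ?invr_ge0.
exists (C + (Q%:R + 1)) => n n0; rewrite unlock; apply/andP; split.
  apply: le_trans (mean_per_ge hr0 hr1 (leqnn Q.+1) sep (hunif n) (hindep n) erefl r_int n0).
  rewrite lee_fin mulrBl [n%:R / _]mulrC.
  have : 0 <= eps * n%:R by rewrite mulr_ge0// ltW.
  by move: (eps * n%:R) (_^-1 * n%:R) (C) C0 => e x c c0 e0; lra.
(* Without a source, [G = Q.+1] makes the hit rate exactly [1 / Q.+1], which matches the lower
   bound. *)
have GQ : (0 < Q.+1 <= Q.+1)%N by rewrite /=.
have src_int : false = false -> Q.+1%:R * r \is a Num.int by [].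
apply: le_trans (mean_per_le hr0 hr1 (leqnn Q.+1) sep (hunif n) (hindep n) src_int GQ) _.
rewrite lee_fin /hit_rate /= !mul0r addr0 mulrDl -/C.
have : 0 <= eps * n%:R by rewrite mulr_ge0// ltW.
have : 0 <= Q%:R :> R by [].
by move: (eps * n%:R) (_^-1 * n%:R) (C) (Q%:R : R) => e x c s; lra.
Qed.
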